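(* Let $\mathcal{X}$ be a covariate space with distribution $P_X$, $\mathcal{F}$ an eligible set of prediction rules with evaluation distribution $\lambda_{\mathcal{F}}$, $\mathcal{F}_\Theta=\{f_\theta:\theta\in\Theta\}$ a model class and $f_{\mathrm{base}}$ a baseline rule. Suppose that for $\lambda_{\mathcal{F}}$-a.e. $f$, $d(f_\theta,f)=\mathbb{E}_{P_X}[g(X,\theta;f)]$ and $d(f_{\mathrm{base}},f)=\mathbb{E}_{P_X}[g_{\mathrm{base}}(X;f)]$ for measurable $g,g_{\mathrm{base}}$, with $\sup_{\theta,f}\mathbb{E}[g(X,\theta;f)^{2+\epsilon}]<\infty$ and $\sup_f\mathbb{E}[g_{\mathrm{base}}(X;f)^{2+\epsilon}]<\infty$ for some $\epsilon>0$. Let $d(\mathcal{F}_\Theta,f):=\inf_\theta d(f_\theta,f)$, and given an i.i.d. sample $X_1,\dots,X_n\sim P_X$ define $d_n(f_\theta,f):=\frac1n\sum_i g(X_i,\theta;f)$, $d_n(\mathcal{F}_\Theta,f):=\inf_\theta d_n(f_\theta,f)$, $d_n(f_{\mathrm{base}},f):=\frac1n\sum_i g_{\mathrm{base}}(X_i;f)$. Assume (asymptotic linearity) that for $\lambda_{\mathcal{F}}$-a.e. $f$ there is a measurable $\phi_1(\cdot;f)$ with $\mathbb{E}[\phi_1(X;f)]=0$, $\mathbb{E}[\phi_1(X;f)^2]<\infty$, and $d_n(\mathcal{F}_\Theta,f)-d(\mathcal{F}_\Theta,f)=\frac1n\sum_{i=1}^n\phi_1(X_i;f)+o_p(n^{-1/2})$.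 Fix $M\ge1$ and draws $f_1,\dots,f_M$ i.i.d. from $\lambda_{\mathcal{F}}$, independent of the sample. Define $\mu_{1,M}:=\frac1M\sum_m d(\mathcal{F}_\Theta,f_m)$, $\mu_{0,M}:=\frac1M\sum_m d(f_{\mathrm{base}},f_m)$ (assumed $>0$), $r_M:=\mu_{1,M}/\mu_{0,M}$, and $\widehat r_{n,M}:=\frac{\frac1M\sum_m d_n(\mathcal{F}_\Theta,f_m)}{\frac1M\sum_m d_n(f_{\mathrm{base}},f_m)}$. Let $\phi_0(x;f):=g_{\mathrm{base}}(x;f)-d(f_{\mathrm{base}},f)$, $\Phi^{(k)}(x):=\frac1M\sum_m\phi_k(x;f_m)$ for $k=0,1$, and $\psi_M(x):=\frac{1}{\mu_{0,M}}\big(\Phi^{(1)}(x)-r_M\Phi^{(0)}(x)\big)$. Then, conditional on $(f_1,\dots,f_M)$, as $n\to\infty$, \[ \sqrt{n}\big(\widehat r_{n,M}-r_M\big)\xrightarrow{d}N(0,\sigma_M^2),\qquad \sigma_M^2:=\mathrm{Var}\big(\psi_M(X_1)\big). \]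
   Context: $d$ is a discrepancy between prediction rules; restrictiveness is the ratio of expected model discrepancy to expected baseline discrepancy under $\lambda_{\mathcal{F}}$, and $\widehat r_{n,M}$ is its Monte Carlo/sample-analog estimator. *)

(* Defs.v *)
From HB Require Import structures.
From mathcomp Require Import all_boot all_order all_algebra.
From mathcomp Require Import all_classical all_reals all_analysis.
Set Implicit Arguments. Unset Strict Implicit. Unset Printing Implicit Defensive.
Import Order.TTheory GRing.Theory Num.Theory.
Import numFieldTopology.Exports numFieldNormedType.Exports.
Local Open Scope classical_set_scope.
Local Open Scope ring_scope.

Section defs.
Context {R : realType}.

Definition iid_seq {dO dX} {Omega : measurableType dO} {Xt : measurableType dX}
  (P : probability Omega R) (X : nat -> Omega -> Xt) (PX : probability Xt R) : Prop :=
  [/\ (forall i, measurable_fun setT (X i)),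
      (forall i (A : set Xt), measurable A -> P (X i @^-1` A) = PX A) &
      (forall (s : seq nat) (A : nat -> set Xt), uniq s ->
         (forall i, measurable (A i)) ->
         P (\bigcap_(i in [set i | i \in s]) (X i @^-1` A i)) =
         (\prod_(i <- s) P (X i @^-1` A i))%E)].

Definition empmean {Omega Xt : Type} (X : nat -> Omega -> Xt) (n : nat)
  (h : Xt -> R) (w : Omega) : R :=
  (n%:R)^-1 * \sum_(i < n) h (X i w).

Definition varP {dX} {Xt : measurableType dX} (PX : probability Xt R) (h : Xt -> R) : R :=
  Rintegral PX setT (fun x => (h x - Rintegral PX setT h) ^+ 2).

(** CDF of N(0, v) (v = variance); for v = 0 this is the point mass at 0 *)
Definition normal_cdf (v t : R) : R :=
  if v == 0 then (if 0 <= t then 1 else 0)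
  else fine (normal_prob 0 (Num.sqrt v) `]-oo, t]).

(** convergence in distribution of (Z n) to N(0, v): convergence of the CDFs
    at every continuity point of the limit CDF *)
Definition cvg_dist_normal {dO} {Omega : measurableType dO}
  (P : probability Omega R) (Z : nat -> Omega -> R) (v : R) : Prop :=
  forall t : R, (v != 0 \/ t != 0) ->
    (fun n => fine (P [set w | Z n w <= t])) @ \oo --> normal_cdf v t.

Definition op_sqrt {dO} {Omega : measurableType dO}
  (P : probability Omega R) (Y : nat -> Omega -> R) : Prop :=
  forall eta : R, 0 < eta ->
    (fun n => fine (P [set w | eta < `| Num.sqrt (n%:R) * Y n w |])) @ \oo --> (0 : R).

End defs.

(* Main.v *)
(** Expanding the ratio, [sqrt n (rhat - r)] equals the normalized empirical
mean of [psi_M] up to a term tending to 0 in probability, so the statement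
reduces to the central limit theorem for i.i.d. square integrable variables.

The central limit theorem is proved by Lindeberg's exchange method, without
characteristic functions and without auxiliary Gaussian variables. With [Phi]
the standard normal cdf, the indicator of [x <= t] is smoothed into [Phi ((t -
x) / e)], and the function [(v, x) |-> Phi ((t - x) / sqrt v)] solves the heat
equation. Hence adding one summand while lowering [v] by its variance changes
the expectation by a quantity which, summed over [n] steps, vanishes as [n]
grows; telescoping from [v = e^2 + sigma^2] down to [v = e^2] gives the limit
[Phi (t / sqrt (e^2 + sigma^2))] for the smoothed cdf. Slutsky's lemma is also
applied at the smoothed level, and [e -> 0] is taken last. The degenerate case
[sigma = 0] needs no separate argument before that last step. *)

Require Import Defs.
From HB Require Import structures.
From mathcomp Require Import all_boot all_order all_algebra.
From mathcomp Require Import all_classical all_reals all_analysis.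
From mathcomp Require Import measurable_realfun.
From mathcomp Require Import ring lra.
Set Implicit Arguments.
Unset Strict Implicit.
Unset Printing Implicit Defensive.

Import Order.TTheory GRing.Theory Num.Theory.
Import numFieldTopology.Exports numFieldNormedType.Exports.
Local Open Scope classical_set_scope.
Local Open Scope ring_scope.

(** * Taylor estimates for the normal distribution function *)

Section taylor.
Context {R : realType}.
Implicit Types f df ddf : R -> R.

(** The endpoints come in either order, which spares later case analyses on the sign of an
    increment. The distance bound on [c] feeds the Taylor remainders; its location between [a] and
    [b] allows bounds that hold only locally. *)
Lemma mvt_between f df (a b : R) : (forall x : R, is_derive x (1:R) f (df x)) ->
  exists c, [/\ `|c - a| <= `|b - a|, Num.min a b <= c <= Num.max a b &
    f b - f a = df c * (b - a)].
Proof.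
move=> fdf.
have cf (x y : R) : {within `[x, y], continuous f}.
  apply/continuous_subspaceT => r.
  by apply/differentiable_continuous/derivable1_diffP; have [] := fdf r.
have [ab|ba] := leP a b.
  have [c /[!in_itv]/= /andP[ac cb] ->] :=
    MVT_segment ab (fun x _ => fdf x) (cf a b).
  exists c; split; [|by rewrite ac cb|by []].
  by rewrite !ger0_norm ?subr_ge0// lerB.
have [c /[!in_itv]/= /andP[bc ca] h] :=
    MVT_segment (ltW ba) (fun x _ => fdf x) (cf b a).
exists c; split; [|by rewrite ca bc|].
  by rewrite !ler0_norm ?subr_le0 ?(ltW ba)// lerN2 lerB.
by rewrite -(opprB (f a)) h -mulrN opprB.
Qed.

(** Two uses of the mean value theorem; the lost factor 1/2 is harmless. The bound on [ddf] is asked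
    only between [a] and [b], since one application has a second derivative controlled only away
    from 0. *)
Lemma taylor1_between f df ddf (K a b : R) :
  (forall x : R, is_derive x (1:R) f (df x)) -> (forall x : R, is_derive x (1:R) df (ddf x)) ->
  (forall x, Num.min a b <= x <= Num.max a b -> `|ddf x| <= K) ->
  `|f b - f a - df a * (b - a)| <= K * (b - a) ^+ 2.
Proof.
move=> fdf dfddf K_; have [c [ca cab ->]] := mvt_between a b fdf.
have [e [_ eac]] := mvt_between a c dfddf.
have {}eac : Num.min a b <= e <= Num.max a b.
  move: eac cab; have [ab|ba] := leP a b; have [ac|ca'] := leP a c; lra.
rewrite -mulrBl => ->; rewrite 2!normrM -[(b - a) ^+ 2]real_normK ?num_real// -mulrA.
apply: ler_pM => //.
- exact: K_.
- by rewrite expr2 ler_wpM2r.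
Qed.

Lemma taylor2_lipschitz f df ddf (K x w : R) :
  (forall x : R, is_derive x (1:R) f (df x)) -> (forall x : R, is_derive x (1:R) df (ddf x)) ->
  (forall y, `|ddf y - ddf x| <= K * `|y - x|) ->
  `|f (x + w) - f x - df x * w - 2^-1 * ddf x * w ^+ 2| <= K * `|w| ^+ 3.
Proof.
move=> fdf dfddf lip.
(* Removing the quadratic Taylor polynomial, up to constants, leaves a function with derivative
   [(ddf e - ddf x) * (c - x)] at [c], for some [e] between [x] and [c]; the Lipschitz bound then
   gives the cube. *)
pose h y := f y - df x * y - 2^-1 * ddf x * (y - x) ^+ 2.
pose dh y := df y - df x - ddf x * (y - x).
have hdh y : is_derive y (1:R) h (dh y).
  by rewrite /h /dh; apply: is_derive_eq; rewrite /GRing.scale /=; field.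
have [c [+ _ hE]] := mvt_between x (x + w) hdh.
rewrite addrAC subrr add0r => cw.
have -> : f (x + w) - f x - df x * w - 2^-1 * ddf x * w ^+ 2 =
          h (x + w) - h x by rewrite /h; ring.
rewrite hE (_ : x + w - x = w) ; last by ring.
rewrite normrM exprSr mulrA ler_wpM2r//.
have [e [ex _ dE]] := mvt_between x c dfddf.
have -> : dh c = (ddf e - ddf x) * (c - x) by rewrite /dh dE; ring.
rewrite normrM expr2 mulrA ler_pM// (le_trans (lip _))//.
have K0 : 0 <= K.
  have := lip (x + 1); rewrite addrAC subrr add0r normr1 mulr1.
  exact: le_trans.
by rewrite ler_wpM2l// (le_trans ex).
Qed.

End taylor.

(** * The normal distribution function: scaling, derivatives and expansions *)

Section standard_normal.
Context {R : realType}.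
Implicit Types s u v w t : R.

(** The parameter [s] is a standard deviation, as in [normal_prob], whereas [normal_cdf] takes a
    variance. *)
Definition gauss_cdf s t : R := fine (normal_prob 0 s `]-oo, t]).

Lemma is_derive_gauss_cdf s t : s != 0 ->
  is_derive t (1:R) (gauss_cdf s) (normal_pdf 0 s t).
Proof.
move=> s0.
(* The interval extends to [t + 1] so that [t] is interior, as the fundamental theorem of calculus
   requires. *)
have i : (@lebesgue_measure R).-integrable `]-oo, t + 1] (EFin \o normal_pdf 0 s).
  apply: (@integrableS _ _ _ _ setT) => //; exact: integrable_normal_pdf.
have tt1 : t < t + 1 by rewrite ltrDl.
have [] := @continuous_FTC1 R (normal_pdf 0 s) (BInfty _ true) t (t + 1) tt1 i.
- exact: ltNyr.
- exact: continuous_normal_pdf.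
rewrite derive1E => d1 d2; exact: DeriveDef d1 d2.
Qed.

Lemma gauss_cdf_ge0 s t : 0 <= gauss_cdf s t.
Proof. by rewrite fine_ge0. Qed.

Lemma gauss_cdf_le1 s t : gauss_cdf s t <= 1.
Proof.
rewrite -lee_fin /gauss_cdf fineK ?fin_num_measure//.
exact: probability_le1.
Qed.

Lemma gauss_cdf_nondecreasing s : {homo gauss_cdf s : x y / x <= y}.
Proof.
move=> x y xy; rewrite fine_le ?fin_num_measure//.
by rewrite le_measure ?inE//; exact: subitvPr.
Qed.

Let idm : {mfun measurableTypeR R >-> R} :=
  HB.pack (idfun : measurableTypeR R -> R)
  (isMeasurableFun.Build _ _ (measurableTypeR R) R idfun (@measurable_id _ _ setT)).

Lemma gauss_cdf_cvgNy s : gauss_cdf s x @[x --> -oo] --> (0 : R).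
Proof. exact/fine_cvg/(@cvg_cdfNy0 _ _ _ (normal_prob 0 s) idm). Qed.

Lemma gauss_cdf_cvgy s : gauss_cdf s x @[x --> +oo] --> (1 : R).
Proof. exact/fine_cvg/(@cvg_cdfy1 _ _ _ (normal_prob 0 s) idm). Qed.

(** The difference of the two sides has zero derivative in [t], hence is constant, and it tends to 0
    at minus infinity. No change of variables in the integral is involved. *)
Lemma gauss_cdf_scale s t : 0 < s -> gauss_cdf s t = gauss_cdf 1 (t / s).
Proof.
move=> s0; pose h x := gauss_cdf s x - gauss_cdf 1 (s^-1 * x).
have hE x : h x = h t.
  apply: is_derive_0_is_cst => y.
  have ds : is_derive y (1:R) (gauss_cdf s) (normal_pdf 0 s y).
    by apply: is_derive_gauss_cdf; rewrite gt_eqF.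
  have dm : is_derive y (1:R) (fun z : R => s^-1 * z) s^-1.
    by apply: is_derive_eq; rewrite /GRing.scale /= mulr1.
  have d1 : is_derive (s^-1 * y) (1:R) (gauss_cdf 1) (normal_pdf 0 1 (s^-1 * y)).
    exact: is_derive_gauss_cdf.
  have := is_deriveB ds (is_derive1_comp d1 dm).
  suff -> : normal_pdf 0 s y - normal_pdf 0 1 (s^-1 * y) / s = 0 by [].
  rewrite !normal_pdfE ?gt_eqF//.
  rewrite /normal_peak /normal_fun !subr0 -mulrnAr sqrtrM ?sqr_ge0//.
  rewrite sqrtr_sqr gtr0_norm// expr1n mul1r.
  rewrite (_ : - (s^-1 * y) ^+ 2 / 2 = - y ^+ 2 / (s ^+ 2 *+ 2)).
    by rewrite invfM; ring.
  by rewrite -mulr_natr; field; rewrite gt_eqF.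
have : h x @[x --> -oo] --> (0 - 0 : R).
  apply: cvgB; first exact: gauss_cdf_cvgNy.
  apply: (cvg_comp (fun x => s^-1 * x) _ _ (gauss_cdf_cvgNy 1)).
  by apply: gt0_cvgMrNy; rewrite ?invr_gt0//; exact: cvg_id.
rewrite (_ : h = fun=> h t); last by apply/funext.
move/cvg_lim => /(_ (@norm_hausdorff _ _)); rewrite lim_cst// subrr /h => /eqP.
by rewrite subr_eq0 mulrC => /eqP.
Qed.

Definition gauss_pdf u : R := normal_pdf 0 1 u.

Lemma gauss_pdfE u :
  gauss_pdf u = normal_peak 1 * expR (- (2^-1 * u ^+ 2)).
Proof.
rewrite /gauss_pdf normal_pdfE ?oner_neq0// /normal_fun subr0 expr1n.
by congr (_ * expR _); rewrite mulNr mulrC.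
Qed.

Lemma is_derive_gauss_pdf u : is_derive u (1:R) gauss_pdf (- u * gauss_pdf u).
Proof.
rewrite (_ : gauss_pdf = (fun u => normal_peak 1 * expR (- (2^-1 * u ^+ 2)))).
  by apply: is_derive_eq; rewrite /GRing.scale /=; field.
by apply/funext => x; rewrite gauss_pdfE.
Qed.

Lemma is_derive_idM_gauss_pdf u :
  is_derive u (1:R) (fun u => - u * gauss_pdf u) ((u ^+ 2 - 1) * gauss_pdf u).
Proof.
have := is_derive_gauss_pdf u => ?.
apply: is_derive_eq; rewrite /GRing.scale /=; ring.
Qed.

Lemma gauss_pdf_ge0 u : 0 <= gauss_pdf u.
Proof. exact: normal_pdf_ge0. Qed.

(** The polynomial is [(1 + u ^+ 2 / 4) ^+ 2], bounded by the square of [expR (u ^+ 2 / 4)], which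
    cancels the exponential of the density. *)
Lemma gauss_pdf_decay u :
  (1 + u ^+ 2 / 2 + u ^+ 4 / 16) * gauss_pdf u <= normal_peak 1.
Proof.
rewrite gauss_pdfE mulrCA ler_piMr ?normal_peak_ge0//.
rewrite expRN -ler_pdivlMr ?invr_gt0 ?expR_gt0// mul1r invrK.
have -> : 2^-1 * u ^+ 2 = u ^+ 2 / 4 + u ^+ 2 / 4 by field.
have e := expR_ge1Dx (u ^+ 2 / 4); rewrite expRD.
have u0 : 0 <= 1 + u ^+ 2 / 4 by rewrite addr_ge0// divr_ge0// sqr_ge0.
apply: le_trans (ler_pM u0 u0 e e).
by rewrite le_eqVlt; apply/orP; left; apply/eqP; field.
Qed.

Lemma gauss_pdf_poly_bounded :
  exists2 C : R, 0 < C & forall u, [/\ `|- u * gauss_pdf u| <= C,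
   `|(u ^+ 2 - 1) * gauss_pdf u| <= C & `|u ^+ 3 * gauss_pdf u| <= C].
Proof.
have p0 := normal_peak_gt0 (oner_neq0 R).
(* The factor 16 clears the coefficient of [u ^+ 4] in [gauss_pdf_decay], so that each of the three
   polynomials is dominated. *)
exists (16 * normal_peak 1); first by rewrite mulr_gt0.
move=> u; have d := gauss_pdf_decay u; have g0 := gauss_pdf_ge0 u.
have b (q : R) : `|q| <= 16 * (1 + u ^+ 2 / 2 + u ^+ 4 / 16) ->
    `|q * gauss_pdf u| <= 16 * normal_peak 1.
  move=> h; rewrite normrM (ger0_norm g0).
  apply: (@le_trans _ _ (16 * (1 + u ^+ 2 / 2 + u ^+ 4 / 16) * gauss_pdf u)).
    by rewrite ler_wpM2r.
  by rewrite -mulrA ler_wpM2l.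
by split; apply: b; rewrite ler_norml; apply/andP; split; nra.
Qed.

(** The remainder is cubic for small [w] and only quadratic for large [w]. This mixed form is
    integrable under a second moment alone, which is what Lindeberg's argument needs. *)
Lemma gauss_cdf_taylor : exists2 C : R, 0 < C & forall u w,
  `|gauss_cdf 1 (u + w) - gauss_cdf 1 u - gauss_pdf u * w
     - 2^-1 * (- u * gauss_pdf u) * w ^+ 2| <= C * (w ^+ 2 * Num.min 1 `|w|).
Proof.
have [C C0 bC] := gauss_pdf_poly_bounded; exists (2 * C); first by rewrite mulr_gt0.
have d1 u : is_derive u (1:R) (gauss_cdf 1) (gauss_pdf u).
  by apply: is_derive_gauss_cdf; rewrite oner_neq0.
move=> u w; have [w1|w1] := leP 1 `|w|.
  have := @taylor1_between _ _ _ _ C u (u + w) d1 is_derive_gauss_pdf.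
  rewrite (_ : u + w - u = w); last by ring.
  move=> /(_ (fun x _ => let: And3 h _ _ := bC x in h)) h.
  rewrite mulr1 (le_trans (ler_normB _ _))//.
  rewrite [leRHS](_ : _ = C * w ^+ 2 + C * w ^+ 2); last by ring.
  apply: lerD => //; rewrite normrM (ger0_norm (sqr_ge0 _)) ler_wpM2r ?sqr_ge0//.
  rewrite normrM ger0_norm ?invr_ge0//; have [h1 _ _] := bC u.
  by have := normr_ge0 (- u * gauss_pdf u); lra.
rewrite (le_trans (@taylor2_lipschitz _ _ _ _ C u w d1 is_derive_gauss_pdf _))//.
  move=> y; have [c [_ _ ->]] := mvt_between u y is_derive_idM_gauss_pdf.
  by rewrite normrM ler_wpM2r//; have [] := bC c.
rewrite exprSr -normrX (ger0_norm (sqr_ge0 _)) ler_wpM2r//.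
  by rewrite mulr_ge0 ?sqr_ge0.
by lra.
Qed.

(* Expanding in the ratio [r] of standard deviations avoids differentiating [sqrt] in the variance. *)
Lemma gauss_cdf_rescale : exists2 C : R, 0 < C & forall u (r r0 : R),
  0 < r0 -> r0 <= r <= 1 ->
  `|gauss_cdf 1 (u * r) - gauss_cdf 1 u - u * gauss_pdf u * (r - 1)|
    <= C / r0 ^+ 2 * (r - 1) ^+ 2.
Proof.
have [C C0 bC] := gauss_pdf_poly_bounded; exists C => // u r r0 r00 /andP[r0r r1].
have dm (x : R) : is_derive x (1:R) (fun z : R => u * z) u.
  by apply: is_derive_eq; rewrite /GRing.scale /= mulr1.
have d1 x : is_derive x (1:R) (gauss_cdf 1 \o (fun z => u * z)) (u * gauss_pdf (u * x)).
  rewrite mulrC; apply: is_derive1_comp.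
  by apply: is_derive_gauss_cdf; rewrite oner_neq0.
have d2 x : is_derive x (1:R) (fun z => u * gauss_pdf (u * z))
    (u * (- (u * x) * gauss_pdf (u * x) * u)).
  have := is_derive1_comp (is_derive_gauss_pdf (u * x)) (dm x) => h.
  apply: (@is_derive_eq _ _ _ _ _ _ _ _ (is_deriveZ u h)).
  by rewrite /GRing.scale.
have := @taylor1_between _ _ _ _ (C / r0 ^+ 2) 1 r d1 d2.
rewrite /= !mulr1; apply => x /andP[h1 h2].
have xr : r0 <= x by move: h1; rewrite (min_idPr r1); exact: le_trans.
have x0 := lt_le_trans r00 xr.
(* In terms of [u * x] the bound becomes uniform in [u], at the price of a factor [x ^- 2]
   controlled by [r0 <= x]. *)
have -> : u * (- (u * x) * gauss_pdf (u * x) * u) =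
   - ((u * x) ^+ 3 * gauss_pdf (u * x)) / x ^+ 2.
  by field; rewrite gt_eqF.
rewrite normrM normrN ler_pM//; first by have [] := bC (u * x).
rewrite ger0_norm ?invr_ge0 ?sqr_ge0// lef_pV2 ?posrE ?exprn_gt0//.
by rewrite ler_pXn2r ?nnegrE ?(ltW r00) ?(ltW x0).
Qed.

End standard_normal.

(** * Independence of an observation from the past *)

Section integrals.
Context d (T : measurableType d) (R : realType) (P : probability T R).
Implicit Types f : T -> R.
Local Notation E f := (Rintegral P setT f).

Lemma bounded_integrable f (C : R) : measurable_fun setT f ->
  (forall x, `|f x| <= C) -> P.-integrable setT (EFin \o f).
Proof.
move=> mf fC; apply: (@le_integrable _ _ _ _ _ _ _ (fun=> C%:E)) => //.
- exact/measurable_EFinP.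
- by move=> x _ /=; rewrite lee_fin (le_trans (fC x))// ler_norm.
- apply/integrableP; split; first exact: measurable_cst.
  by rewrite integral_cst//= probability_setT mule1 ltry.
Qed.

Lemma integrable_cst_prob (c : R) : P.-integrable setT (EFin \o (fun=> c)).
Proof. exact: (@bounded_integrable (fun=> c) `|c|). Qed.

Lemma Rintegral_cst_prob (c : R) : E (fun=> c) = c.
Proof. by rewrite /Rintegral integral_cst//= probability_setT mule1. Qed.

Lemma dominated_integrable_real f g : measurable_fun setT f ->
  (forall x, `|f x| <= g x) -> P.-integrable setT (EFin \o g) ->
  P.-integrable setT (EFin \o f).
Proof.
move=> mf fg; apply: le_integrable => //; first exact/measurable_EFinP.
by move=> x _ /=; rewrite lee_fin (le_trans (fg x))// ler_norm.
Qed.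

Lemma integrableD_real f g : P.-integrable setT (EFin \o f) ->
  P.-integrable setT (EFin \o g) ->
  P.-integrable setT (EFin \o (fun x => f x + g x)).
Proof. by move=> fi gi; exact: (integrableD _ fi gi). Qed.

Lemma integrableB_real f g : P.-integrable setT (EFin \o f) ->
  P.-integrable setT (EFin \o g) ->
  P.-integrable setT (EFin \o (fun x => f x - g x)).
Proof. by move=> fi gi; exact: (integrableB _ fi gi). Qed.

Lemma integrableZ_real (k : R) f : P.-integrable setT (EFin \o f) ->
  P.-integrable setT (EFin \o (fun x => k * f x)).
Proof. by move=> fi; exact: (integrableZl _ k fi). Qed.

End integrals.

Section independence.
Context dO dX (Omega : measurableType dO) (Xt : measurableType dX)
  (R : realType).
Variables (P : probability Omega R) (PX : probability Xt R)
  (X : nat -> Omega -> Xt).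
Hypothesis hX : iid_seq P X PX.

Let mX i : measurable_fun setT (X i). Proof. by have [] := hX. Qed.

Lemma iid_integral_comp i (h : Xt -> R) : measurable_fun setT h ->
  PX.-integrable setT (EFin \o h) ->
  P.-integrable setT (EFin \o (h \o X i)) /\
  Rintegral P setT (h \o X i) = Rintegral PX setT h.
Proof.
move=> mh hi.
pose Xi : {mfun Omega >-> Xt} := HB.pack (X i) (isMeasurableFun.Build _ _ _ _ _ (mX i)).
have XiPX A : measurable A -> distribution P Xi A = PX A.
  by have [_ law _] := hX; exact: law.
have mhX : measurable_fun setT (EFin \o (h \o X i)).
  by apply/measurable_EFinP; exact: measurableT_comp.
have hiX : P.-integrable setT (EFin \o (h \o X i)).
  move/integrableP : hi => [mE hfin]; apply/integrableP; split => //.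
  rewrite (_ : (\int[P]_x _)%E = (\int[PX]_x `|(EFin \o h) x|)%E)//.
  rewrite -(ge0_integral_distribution Xi (f := fun x => `|(EFin \o h) x|%E))//.
    by apply: eq_measure_integral => A mA _; exact: XiPX.
  exact: measurableT_comp.
split=> //; congr fine.
rewrite -(integral_distribution (X := Xi) (f := EFin \o h))//.
  by apply: eq_measure_integral => A mA _; exact: XiPX.
exact/measurable_EFinP.
Qed.

(* A pi-system generating the sigma-algebra of [X 0], ..., [X k.-1]. *)
Definition past_sets k : set (set Omega) := [set C | exists A : nat -> set Xt,
  (forall i, measurable (A i)) /\
  C = \bigcap_(i in [set i | i \in iota 0 k]) (X i @^-1` A i)].

Let mXA i A : measurable A -> measurable (X i @^-1` A).
Proof. by move=> mA; rewrite -[X in measurable X]setTI; exact: mX. Qed.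

Lemma past_sets_measurable k : past_sets k `<=` measurable.
Proof. by move=> _ [A [mA ->]]; apply: bigcap_measurableType => i _; exact: mXA. Qed.

Lemma past_setsT k : past_sets k setT.
Proof.
exists (fun=> setT); split => //; apply/esym.
by rewrite -subTset => w _ i _.
Qed.

Lemma past_sets_setI k : setI_closed (past_sets k).
Proof.
move=> _ _ [A [mA ->]] [B [mB ->]]; exists (fun i => A i `&` B i); split.
  by move=> i; exact: measurableI.
by rewrite -bigcapI.
Qed.

(** Both sides are finite measures in [D]; they agree on the pi-system [past_sets k] by
    independence, hence on the sigma-algebra it generates. *)
Lemma past_indep k (D : set Omega) (B : set Xt) : measurable B ->
  <<s past_sets k >> D -> P (D `&` X k @^-1` B) = (P D * PX B)%E.
Proof.
move=> mB sD; have [_ law indep] := hX.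
have mXB := mXA k mB.
have r0 : 0 <= fine (PX B) by rewrite fine_ge0.
pose m1 := mrestr P mXB; pose m2 := mscale (NngNum r0) P.
have : m1 D = m2 D; last first.
  rewrite /m1 /m2 /mrestr /mscale /= => ->.
  by rewrite fineK ?fin_num_measure// muleC.
apply: (g_sigma_algebra_measure_unique (past_sets k) _ (fun=> setT)) => //.
- exact: past_sets_measurable.
- by move=> _; exact: past_setsT.
- by rewrite -subTset => w _; exists 0%N.
- exact: past_sets_setI.
- move=> _ [A [mA ->]]; rewrite /= /mrestr /mscale /=.
  (* Placing [B] at index [k] turns the intersection into a cylinder over [k :: iota 0 k], to which
     the product formula applies. *)
  pose A' i := if i == k then B else A i.
  have mA' i : measurable (A' i) by rewrite /A'; case: ifP.
  have ki : k \notin iota 0 k by rewrite mem_iota add0n ltnn andbF.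
  have A'A i : i \in iota 0 k -> A' i = A i.
    by rewrite /A'; case: eqP => // ->; rewrite (negbTE ki).
  have -> : \bigcap_(i in [set i | i \in iota 0 k]) (X i @^-1` A i) `&` X k @^-1` B
      = \bigcap_(i in [set i | i \in k :: iota 0 k]) (X i @^-1` A' i).
    apply/seteqP; split => [w [h hk] i|w h].
      rewrite /= inE => /orP[/eqP ->|ik]; first by rewrite /A' eqxx.
      by rewrite A'A//; exact: h.
    split.
      move=> i /= ik; rewrite -A'A//; apply: h.
      by rewrite /= inE ik orbT.
    by have := h k (mem_head _ _); rewrite /A' eqxx.
  rewrite !indep//= ?iota_uniq ?ki// big_cons {1}/A' eqxx law//.
  rewrite fineK ?fin_num_measure//; congr (_ * _)%E.
  by apply: eq_big_seq => i ik; rewrite A'A.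
- by move=> _; rewrite /m1 /mrestr -ge0_fin_numE// fin_num_measure//; exact: measurableI.
Qed.

Definition past_measurable k (S : Omega -> R) : Prop :=
  forall A, measurable A -> <<s past_sets k >> (S @^-1` A).

Lemma past_measurable_fun k S : past_measurable k S -> measurable_fun setT S.
Proof.
move=> pS _ A mA; rewrite setTI.
apply: (smallest_sub (@sigma_algebra_measurable _ Omega) (@past_sets_measurable k)).
exact: pS.
Qed.

Lemma past_measurable_sum k (h : Xt -> R) : measurable_fun setT h ->
  past_measurable k (fun w => \sum_(i < k) h (X i w)).
Proof.
move=> mh A mA.
have : measurable_fun setT (fun w : g_sigma_algebraType (past_sets k) =>
    \sum_(i < k) h (X i w)).
  apply: measurable_sum => i; apply: measurableT_comp => //.
  move=> _ B mB; rewrite setTI; apply: sub_sigma_algebra.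
  (* The preimage of [B] under [X i] is the cylinder unconstrained at all other indices. *)
  exists (fun j : nat => if j == i then B else setT); split.
    by move=> j; case: ifP.
  apply/seteqP; split => [w Bw j _|w /(_ (val i))].
    by case: eqP => // ->.
  by rewrite eqxx; apply; rewrite /= mem_iota add0n ltn_ord.
by move=> /(_ measurableT A mA); rewrite setTI.
Qed.

(** By [past_indep] the joint law of [S] and [X k] is the product of their laws, and Fubini's
    theorem factors the integral. Boundedness of [a] and integrability of [b] make the product
    integrable. *)
Lemma past_product k S (a : R -> R) (C : R) (b : Xt -> R) :
  past_measurable k S ->
  measurable_fun setT a -> (forall s, `|a s| <= C) ->
  measurable_fun setT b -> PX.-integrable setT (EFin \o b) ->
  P.-integrable setT (EFin \o (fun w => a (S w) * b (X k w))) /\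
  Rintegral P setT (fun w => a (S w) * b (X k w)) =
  Rintegral P setT (a \o S) * Rintegral PX setT b.
Proof.
move=> pS ma aC mb ib; have mS := past_measurable_fun pS.
have C0 : 0 <= C by rewrite (le_trans _ (aC 0)).
have [ibX _] := iid_integral_comp k mb ib.
have maS : measurable_fun setT (a \o S) by exact: measurableT_comp.
have mbX : measurable_fun setT (b \o X k) by exact: measurableT_comp.
have iab : P.-integrable setT (EFin \o (fun w => a (S w) * b (X k w))).
  apply: (@dominated_integrable_real _ _ _ _ _ (fun w => C * `|b (X k w)|)).
  - exact: measurable_funM.
  - by move=> w; rewrite normrM ler_wpM2r.
  - by apply: integrableZ_real; exact: (integrable_norm ibX).
split => //.
pose Sm : {mfun Omega >-> R} := HB.pack S (isMeasurableFun.Build _ _ _ _ _ mS).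
pose T w := (S w, X k w).
have mT : measurable_fun setT T.
  by apply/measurable_fun_pairP; split; [exact: mS|exact: mX].
pose Tm : {mfun Omega >-> (R * Xt)%type} :=
  HB.pack T (isMeasurableFun.Build _ _ _ _ _ mT).
pose f (z : R * Xt) : \bar R := (a z.1 * b z.2)%:E.
have mf : measurable_fun setT f.
  apply/measurable_EFinP; apply: measurable_funM.
    by apply: measurableT_comp => //; exact: measurable_fst.
  by apply: measurableT_comp => //; exact: measurable_snd.
(* A product measure is determined by its values on rectangles, where [past_indep] gives them. *)
have prodE (A : set (R * Xt)) : measurable A ->
    (distribution P Sm \x PX)%E A = distribution P Tm A.
  apply: product_measure_unique => A1 A2 mA1 mA2.
  rewrite -(past_indep mA2 (pS _ mA1)); congr (P _).
have ifT : (distribution P Tm).-integrable setT f.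
  by apply: (integrable_pushforward (phi := T)) => //; rewrite preimage_setT.
have ifp : (distribution P Sm \x PX)%E.-integrable setT f.
  move/integrableP : ifT => [_ fin]; apply/integrableP; split => //.
  rewrite (eq_measure_integral (distribution P Tm))// => A mA _; exact: prodE.
have -> : Rintegral P setT (fun w => a (S w) * b (X k w)) =
    fine (\int[distribution P Sm]_s ((a s * Rintegral PX setT b)%:E)).
  congr fine; rewrite -(integral_distribution (X := Tm) (f := f))//.
  transitivity (\int[(distribution P Sm \x PX)%E]_z f z)%E.
    by apply: eq_measure_integral => A mA _; exact/esym/prodE.
  rewrite -integral12_prod_meas1//; apply: eq_integral => s _.
  rewrite /fubini_F /f /=.
  under eq_integral do rewrite EFinM.
  rewrite integralZl// EFinM; congr (_ * _)%E.
  by rewrite /Rintegral fineK//; exact: integrable_fin_num.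
have iaS : P.-integrable setT (EFin \o (a \o S)).
  by apply: (@bounded_integrable _ _ _ _ _ C) => // w; exact: aC.
rewrite -RintegralZr//; congr fine.
rewrite (integral_distribution (X := Sm))//.
  by apply/measurable_EFinP; apply: measurable_funM.
under eq_fun do rewrite mulrC.
exact: integrableZ_real.
Qed.

End independence.

(** * Lindeberg's exchange argument *)

Section lindeberg.
Context {R : realType}.
Implicit Types s t u v w y : R.

(** Extracts the scale [a] from the remainder of [gauss_cdf_taylor], so that the error of an
    exchange step depends on the increment [y] alone. *)
Lemma min1_normM (a A y : R) : 0 <= a <= A -> 1 <= A ->
  (a * y) ^+ 2 * Num.min 1 `|a * y| <= A ^+ 3 * (y ^+ 2 * Num.min 1 `|y|).
Proof.
move=> /andP[a0 aA] A1; have A0 : 0 <= A by rewrite (le_trans _ A1).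
have -> : A ^+ 3 * (y ^+ 2 * Num.min 1 `|y|) =
  (A ^+ 2 * y ^+ 2) * (A * Num.min 1 `|y|) by ring.
apply: ler_pM; rewrite ?sqr_ge0 ?le_min ?ler01 ?normr_ge0//.
  by rewrite exprMn ler_wpM2r ?sqr_ge0// ler_sqr ?nnegrE.
rewrite ge_min normrM (ger0_norm a0) minr_pMr// mulr1 le_min.
have ay : a * `|y| <= A * `|y| by rewrite ler_wpM2r.
by have [h|/ltW h] := leP A (A * `|y|); rewrite ?ay ?A1 ?orbT ?(le_trans A1).
Qed.

(* The exchange step of Lindeberg's method: [gauss_cdf 1 ((t - s) / sqrt v)] solves the
   heat equation in [(v, s)], so moving [s] by [y] and lowering the variance by
   [de] cancel to second order. *)
Lemma heat_exchange (e2 V : R) : 0 < e2 -> exists2 K : R, 0 < K &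
  forall t s y v de, e2 <= v -> 0 <= de -> v + de <= V ->
  forall a u, a = (Num.sqrt v)^-1 -> u = (t - s) * a ->
  `|gauss_cdf 1 ((t - (s + y)) / Num.sqrt v)
    - gauss_cdf 1 ((t - s) / Num.sqrt (v + de))
    - (- a * gauss_pdf u * y + 2^-1 * a ^+ 2 * (- u * gauss_pdf u) * (y ^+ 2 - de))|
  <= K * (y ^+ 2 * Num.min 1 `|y| + de ^+ 2).
Proof.
move=> e0; have [C1 C10 taylor] := @gauss_cdf_taylor R.
have [C2 C20 rescale] := @gauss_cdf_rescale R.
have [C3 C30 bound] := @gauss_pdf_poly_bounded R.
(* [A] dominates the inverse standard deviations and is at least 1, as [min1_normM] asks; [B] is a
   positive upper bound for the variances, valid even without a sign on [V]. *)
pose A := 1 + (Num.sqrt e2)^-1; pose B := Num.max V e2.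
have B0 : 0 < B by rewrite lt_max e0 orbT.
have A1 : 1 <= A by rewrite lerDl invr_ge0 sqrtr_ge0.
have K1 : 0 < C1 * A ^+ 3 by rewrite mulr_gt0// exprn_gt0// (lt_le_trans _ A1).
have K2 : 0 < (C2 / (e2 / B) + C3 + C3) / e2 ^+ 2.
  by rewrite divr_gt0 ?exprn_gt0// !addr_gt0// !divr_gt0.
exists (C1 * A ^+ 3 + (C2 / (e2 / B) + C3 + C3) / e2 ^+ 2).
  exact: addr_gt0.
move=> t s y v de ev de0 vV a u aE uaE.
have v0 : 0 < v by exact: lt_le_trans ev.
have vde0 : 0 < v + de by rewrite (lt_le_trans v0)// lerDl.
have sv0 : 0 < Num.sqrt v by rewrite sqrtr_gt0.
have svde0 : 0 < Num.sqrt (v + de) by rewrite sqrtr_gt0.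
have a0 : 0 <= a by rewrite aE invr_ge0 ltW.
have a2 : a ^+ 2 = v^-1 by rewrite aE exprVn sqr_sqrtr// ltW.
have aA : a <= A.
  rewrite aE (@le_trans _ _ (Num.sqrt e2)^-1)// ?lerDr//.
  by rewrite lef_pV2 ?posrE ?sqrtr_gt0// ler_wsqrtr.
(* Passing from variance [v] to [v + de] multiplies the argument [u] by [r], and [r] stays above the
   constant [r_] below. *)
pose r := Num.sqrt v / Num.sqrt (v + de).
have r0 : 0 <= r by rewrite divr_ge0 ?ltW.
have r2 : r ^+ 2 = v / (v + de) by rewrite expr_div_n !sqr_sqrtr ?ltW.
have r1 : r <= 1 by rewrite ler_pdivrMr// mul1r ler_wsqrtr// lerDl.
pose r_ := Num.sqrt (e2 / B).
have r_0 : 0 < r_ by rewrite sqrtr_gt0 divr_gt0.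
have r_2 : r_ ^+ 2 = e2 / B by rewrite sqr_sqrtr// ltW// divr_gt0.
have r_r : r_ <= r.
  rewrite -ler_sqr ?nnegrE ?(ltW r_0)// r2 r_2.
  rewrite ler_pM ?invr_ge0 ?(ltW e0) ?(ltW B0)//.
  by rewrite lef_pV2 ?posrE// le_max vV.
(* Since [0 <= r <= 1], [1 - r <= 1 - r ^+ 2 = de / (v + de)], so the squared defect is of order
   [de ^+ 2]. *)
have rm1 : (r - 1) ^+ 2 <= de ^+ 2 / e2 ^+ 2.
  have -> : de ^+ 2 / e2 ^+ 2 = (de / e2) ^+ 2 by rewrite expr_div_n.
  rewrite -[(r - 1) ^+ 2]sqrrN opprB ler_sqr ?nnegrE ?subr_ge0// ?divr_ge0 ?(ltW e0)//.
  have h1 : 1 - r <= 1 - r ^+ 2 by rewrite lerD2l lerN2 expr2 ler_piMl.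
  apply: (le_trans h1); rewrite r2.
  have -> : 1 - v / (v + de) = de / (v + de) by field; rewrite gt_eqF.
  rewrite ler_wpM2l// lef_pV2 ?posrE//; lra.
have uE : (t - s) / Num.sqrt (v + de) = u * r.
  by rewrite uaE aE /r; field; rewrite !gt_eqF.
have uyE : (t - (s + y)) / Num.sqrt v = u + - (a * y).
  by rewrite uaE aE; ring.
rewrite uE uyE.
have h1 := taylor u (- (a * y)).
have h2 := rescale u r r_ r_0; rewrite r_r r1 r_2 in h2; have {}h2 := h2 isT.
have [h3 _ _] := bound u.
have h4 := @min1_normM a A y; rewrite a0 aA A1 in h4; have {}h4 := h4 isT isT.
move: h1 h2; rewrite sqrrN normrN.
set P0 := gauss_cdf 1 (u + _); set P1 := gauss_cdf 1 (u * r).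
set P2 := gauss_cdf 1 u; set p := gauss_pdf u in h3 *.
set R1 := (X in `|X| <= _) => h1; set R2 := (X in `|X| <= _) => h2.
(* By the identity [r ^+ 2 - 1 = 2 * (r - 1) + (r - 1) ^+ 2], the first-order rescaling term cancels
   the [de] term of the expansion. What remains is [(r - 1) ^+ 2] and the gap between [de / v] and
   [de / (v + de)], both of order [de ^+ 2]. *)
rewrite (_ : P0 - P1 - _ = R1 - R2 + 2^-1 * (u * p) * (r - 1) ^+ 2
    - 2^-1 * (u * p) * (de ^+ 2 / (v * (v + de)))); last first.
  rewrite a2 /R1 /R2 -a2.
  have E : (r - 1) ^+ 2 = v / (v + de) - 1 - 2 * (r - 1) by rewrite -r2; ring.
  rewrite E exprMn a2; field.
  by rewrite !gt_eqF.
have e3 : `|2^-1 * (u * p) * (r - 1) ^+ 2| <= C3 * (de ^+ 2 / e2 ^+ 2).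
  rewrite normrM (ger0_norm (sqr_ge0 _)) ler_pM ?sqr_ge0//.
  by rewrite normrM ger0_norm ?invr_ge0//; rewrite mulNr normrN in h3;
      have := normr_ge0 (u * p); lra.
have e4 : `|2^-1 * (u * p) * (de ^+ 2 / (v * (v + de)))| <= C3 * (de ^+ 2 / e2 ^+ 2).
  have x0 : 0 <= de ^+ 2 / (v * (v + de)) by rewrite divr_ge0 ?sqr_ge0// ltW// mulr_gt0.
  rewrite normrM (ger0_norm x0) ler_pM//.
    by rewrite normrM ger0_norm ?invr_ge0//; rewrite mulNr normrN in h3;
      have := normr_ge0 (u * p); lra.
  rewrite ler_wpM2l ?sqr_ge0// lef_pV2 ?posrE ?mulr_gt0 ?exprn_gt0// expr2.
  by rewrite ler_pM ?(ltW e0)//; lra.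
have e1 : `|R1| <= C1 * (A ^+ 3 * (y ^+ 2 * Num.min 1 `|y|)).
  by rewrite (le_trans h1)// ler_wpM2l// ltW.
have e2' : `|R2| <= C2 / (e2 / B) * (de ^+ 2 / e2 ^+ 2).
  by rewrite (le_trans h2)// ler_wpM2l// ltW// !divr_gt0.
have m0 : 0 <= y ^+ 2 * Num.min 1 `|y|.
  by rewrite mulr_ge0 ?sqr_ge0// le_min ler01 normr_ge0.
have d0 : 0 <= de ^+ 2 by rewrite sqr_ge0.
apply: (@le_trans _ _ (C1 * A ^+ 3 * (y ^+ 2 * Num.min 1 `|y|)
    + (C2 / (e2 / B) + C3 + C3) / e2 ^+ 2 * de ^+ 2)); last first.
  rewrite mulrDl !mulrDr; have := mulr_ge0 (ltW K1) d0.
  by have := mulr_ge0 (ltW K2) m0; lra.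
have -> : (C2 / (e2 / B) + C3 + C3) / e2 ^+ 2 * de ^+ 2 =
  C2 / (e2 / B) * (de ^+ 2 / e2 ^+ 2) + C3 * (de ^+ 2 / e2 ^+ 2)
  + C3 * (de ^+ 2 / e2 ^+ 2) by ring.
rewrite mulrA in e1; move: e1 e2' e3 e4.
set X1 := 2^-1 * (u * p) * (r - 1) ^+ 2; set X2 := 2^-1 * (u * p) * _.
have : `|R1 - R2 + X1 - X2| <= `|R1| + `|R2| + `|X1| + `|X2|.
  apply: (le_trans (ler_normB _ _)); rewrite lerD2r.
  by apply: (le_trans (ler_normD _ _)); rewrite lerD2r ler_normB.
by lra.
Qed.

Lemma gauss_cdf_continuous s : s != 0 -> continuous (gauss_cdf (R:=R) s).
Proof.
move=> s0 x; apply/differentiable_continuous/derivable1_diffP.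
by have [] := is_derive_gauss_cdf x s0.
Qed.

Lemma measurable_gauss_cdf s : measurable_fun setT (gauss_cdf (R:=R) s).
Proof.
by apply: nondecreasing_measurable => //; exact: gauss_cdf_nondecreasing.
Qed.

Lemma measurable_gauss_pdf : measurable_fun setT (@gauss_pdf R).
Proof. exact: measurable_normal_pdf. Qed.

Lemma normal_cdf_gauss v t : 0 < v -> normal_cdf v t = gauss_cdf 1 (t / Num.sqrt v).
Proof.
move=> v0; rewrite /normal_cdf gt_eqF//.
by rewrite -gauss_cdf_scale// sqrtr_gt0.
Qed.

End lindeberg.

(** * The central limit theorem for smoothed indicators *)

Section smooth_clt.
Context dO dX (Omega : measurableType dO) (Xt : measurableType dX)
  (R : realType).
Variables (P : probability Omega R) (PX : probability Xt R)
  (X : nat -> Omega -> Xt).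
Hypothesis hX : iid_seq P X PX.
Implicit Types (t s v e : R) (h : Xt -> R) (S : Omega -> R).

Lemma measurable_affine_comp (f : R -> R) t (a : R) :
  measurable_fun setT f -> measurable_fun setT (fun s => f ((t - s) * a)).
Proof.
move=> mf; apply: measurableT_comp => //; apply: measurable_funM => //.
exact: measurable_funB.
Qed.

Lemma gauss_cdf_norm_le1 (u : R) : `|gauss_cdf 1 u| <= 1.
Proof. by rewrite ger0_norm ?gauss_cdf_ge0// gauss_cdf_le1. Qed.

Lemma integrable_gauss_cdf_comp S t (a : R) : measurable_fun setT S ->
  P.-integrable setT (EFin \o (fun w => gauss_cdf 1 ((t - S w) * a))).
Proof.
move=> mS; apply: (@bounded_integrable _ _ _ _ _ 1); last first.
  by move=> w; exact: gauss_cdf_norm_le1.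
apply: (measurableT_comp (measurable_affine_comp t a (measurable_gauss_cdf 1))).
exact: mS.
Qed.

Lemma min1_bound (y z : R) : `|y ^+ 2 * Num.min 1 `|z| | <= y ^+ 2.
Proof.
have m0 : 0 <= Num.min 1 `|z| by rewrite le_min ler01 normr_ge0.
rewrite normrM (ger0_norm (sqr_ge0 _)) (ger0_norm m0).
by rewrite ler_piMr ?sqr_ge0// ge_min lexx.
Qed.

Lemma telescope_bound (a : nat -> R) (b : R) n :
  (forall k, (k < n)%N -> `|a k.+1 - a k| <= b) -> `|a n - a 0%N| <= n%:R * b.
Proof.
elim: n => [|n IH] ab; first by rewrite subrr normr0 mul0r.
have -> : a n.+1 - a 0%N = (a n.+1 - a n) + (a n - a 0%N) by ring.
rewrite (le_trans (ler_normD _ _))// -natr1 mulrDl mul1r addrC lerD ?ab//.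
by apply: IH => k kn; apply: ab; exact: ltnW.
Qed.

(** Integrating [heat_exchange]: the linear term vanishes because [h] is centred and independent of
    the past, the quadratic one because [de] is exactly the second moment of [h]. The constant [K]
    depends only on [e2] and [V], so the errors of all steps can be summed. *)
Lemma lindeberg_step (e2 V : R) : 0 < e2 -> exists2 K : R, 0 < K &
  forall k S h t v de, past_measurable X k S ->
  measurable_fun setT h ->
  PX.-integrable setT (EFin \o h) -> Rintegral PX setT h = 0 ->
  PX.-integrable setT (EFin \o (fun x => h x ^+ 2)) ->
  Rintegral PX setT (fun x => h x ^+ 2) = de ->
  e2 <= v -> v + de <= V ->
  `|Rintegral P setT (fun w => gauss_cdf 1 ((t - (S w + h (X k w))) / Num.sqrt v))
    - Rintegral P setT (fun w => gauss_cdf 1 ((t - S w) / Num.sqrt (v + de)))|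
  <= K * (Rintegral PX setT (fun x => h x ^+ 2 * Num.min 1 `|h x|) + de ^+ 2).
Proof.
move=> e20; have [K K0 HK] := heat_exchange V e20.
exists K => // k S h t v de pS mh ih h0 ih2 hde ev vV.
have de0 : 0 <= de by rewrite -hde; apply: Rintegral_ge0 => x _; exact: sqr_ge0.
have mS := past_measurable_fun hX pS.
have mX i : measurable_fun setT (X i) by have [] := hX.
have mhX : measurable_fun setT (h \o X k) by exact: measurableT_comp.
have mh2 : measurable_fun setT (fun x => h x ^+ 2) by exact: measurable_funX.
pose a := (Num.sqrt v)^-1; pose u s := (t - s) * a.
(* The coefficients of the expansion are bounded functions of the past sum, as [past_product]
   requires. *)
pose al s := - a * gauss_pdf (u s).
pose be s := 2^-1 * a ^+ 2 * (- u s * gauss_pdf (u s)).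
have mal : measurable_fun setT al.
  by apply: measurable_funM => //; exact: (measurable_affine_comp t a measurable_gauss_pdf).
have mbe : measurable_fun setT be.
  apply: measurable_funM => //; apply: (@measurable_affine_comp (fun u => - u * gauss_pdf u) t a).
  by apply: measurable_funM => //; exact: measurable_gauss_pdf.
have al_bd s : `|al s| <= `|a| * normal_peak 1.
  rewrite /al normrM normrN ler_wpM2l// ger0_norm ?gauss_pdf_ge0//.
  by apply: normal_pdf_ub; exact: oner_neq0.
have [C C0 bC] := @gauss_pdf_poly_bounded R.
have be_bd s : `|be s| <= `|2^-1 * a ^+ 2| * C.
  by rewrite /be normrM ler_wpM2l//; have [] := bC (u s).
have i1 : PX.-integrable setT (EFin \o (fun x => h x ^+ 2 - de)).
  apply: integrableB_real => //.
  exact: integrable_cst_prob.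
have m1 : measurable_fun setT (fun x => h x ^+ 2 - de) by exact: measurable_funB.
have [ia Ea] := past_product hX pS mal al_bd mh ih.
have [ib Eb] := past_product hX pS mbe be_bd m1 i1.
rewrite h0 mulr0 in Ea.
rewrite RintegralB//= in Eb; last exact: integrable_cst_prob.
rewrite Rintegral_cst_prob hde subrr mulr0 in Eb.
pose F1 w := gauss_cdf 1 ((t - (S w + h (X k w))) / Num.sqrt v).
pose F0 w := gauss_cdf 1 ((t - S w) / Num.sqrt (v + de)).
have iF1 : P.-integrable setT (EFin \o F1).
  by apply: (@integrable_gauss_cdf_comp (fun w => S w + h (X k w))); exact: measurable_funD.
have iF0 : P.-integrable setT (EFin \o F0) by exact: integrable_gauss_cdf_comp.
pose L w := al (S w) * h (X k w) + be (S w) * (h (X k w) ^+ 2 - de).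
have iL : P.-integrable setT (EFin \o L) by exact: integrableD_real.
have EL : Rintegral P setT L = 0 by rewrite /L RintegralD// Ea Eb addr0.
have iF : P.-integrable setT (EFin \o (fun w => F1 w - F0 w)) by exact: integrableB_real.
rewrite -RintegralB// -[X in `|X|]subr0 -EL -RintegralB//.
have iD : P.-integrable setT (EFin \o (fun w => F1 w - F0 w - L w)) by exact: integrableB_real.
apply: (le_trans (le_normr_Rintegral _ iD)) => //.
pose q x := h x ^+ 2 * Num.min 1 `|h x|.
have mq : measurable_fun setT q.
  apply: measurable_funM => //; apply: measurable_minr => //.
  exact: measurableT_comp.
have iq : PX.-integrable setT (EFin \o q).
  apply: (@dominated_integrable_real _ _ _ _ _ (fun x => h x ^+ 2)) => // x.
  exact: min1_bound.
have [iqX EqX] := iid_integral_comp hX k mq iq.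
have ic : P.-integrable setT (EFin \o (fun=> de ^+ 2)).
  exact: integrable_cst_prob.
have iqd : P.-integrable setT (EFin \o (fun w => (q \o X k) w + de ^+ 2)).
  exact: integrableD_real.
apply: (@le_trans _ _ (Rintegral P setT (fun w => K * ((q \o X k) w + de ^+ 2)))).
  apply: le_Rintegral => //.
  - exact: (integrable_norm iD).
  - exact: integrableZ_real.
  - by move=> w _; exact: HK.
by rewrite RintegralZl// RintegralD// EqX Rintegral_cst_prob.
Qed.

Variables (psi : Xt -> R).
Hypotheses (mpsi : measurable_fun setT psi)
  (ipsi : PX.-integrable setT (EFin \o psi)) (psi0 : Rintegral PX setT psi = 0)
  (ipsi2 : PX.-integrable setT (EFin \o (fun x => psi x ^+ 2))).
Let s2 := Rintegral PX setT (fun x => psi x ^+ 2).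

Lemma inv_sqrt_cvg0 : (Num.sqrt (n%:R : R))^-1 @[n --> \oo] --> (0 : R).
Proof.
apply/gtr0_cvgV0.
  by near=> n; rewrite sqrtr_gt0 ltr0n; near: n; exact: nbhs_infty_gt.
apply/cvgryPge => A; near=> n.
rewrite (@le_trans _ _ `|A|) ?ler_norm// -sqrtr_sqr ler_wsqrtr//.
by near: n; exact: nbhs_infty_ger.
Unshelve. all: by end_near. Qed.

Let trunc n x := psi x ^+ 2 * Num.min 1 `|(Num.sqrt n%:R)^-1 * psi x|.

(** This is Lindeberg's condition with [Num.min 1] in place of a truncation indicator. The integrand
    tends to 0 pointwise and is dominated by [psi x ^+ 2]. *)
Lemma truncated_moment_cvg0 : Rintegral PX setT (trunc n) @[n --> \oo] --> (0 : R).
Proof.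
have min_ge0 (y : R) : 0 <= Num.min 1 `|y| by rewrite le_min ler01 normr_ge0.
have mt n : measurable_fun setT (trunc n).
  apply: measurable_funM => //; first exact: measurable_funX.
  apply: measurable_minr => //; apply: measurableT_comp => //.
  exact: measurable_funM.
have [|||||_ _ h] := @dominated_convergence _ _ _ PX setT measurableT
  (fun n x => (trunc n x)%:E) (cst 0%E) (fun x => (psi x ^+ 2)%:E).
- by move=> n; exact/measurable_EFinP.
- exact: measurable_cst.
- apply: aeW => x _; apply: cvg_EFin; first exact: nearW.
  apply: (@squeeze_cvgr _ _ _ _ (cst 0) (fun n => psi x ^+ 2 * `|psi x| * (Num.sqrt n%:R)^-1)).
  + apply: nearW => n /=; rewrite mulr_ge0 ?sqr_ge0//= -mulrA ler_wpM2l ?sqr_ge0//.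
    by rewrite ge_min normrM ger0_norm ?invr_ge0// mulrC lexx orbT.
  + exact: cvg_cst.
  + by rewrite -[X in _ --> X](mulr0 (psi x ^+ 2 * `|psi x|)); apply: cvgMl_tmp; exact: inv_sqrt_cvg0.
- exact: ipsi2.
- by apply: aeW => x n _; rewrite lee_fin min1_bound.
by move: h; rewrite integral_cst// mul0e => /fine_cvg.
Qed.

Lemma smooth_clt e t : 0 < e ->
  Rintegral P setT
    (fun w => gauss_cdf 1 ((t - Num.sqrt n%:R * empmean X n psi w) / e)) @[n --> \oo]
  --> gauss_cdf 1 (t / Num.sqrt (e ^+ 2 + s2)).
Proof.
move=> e0; have e20 : 0 < e ^+ 2 by rewrite exprn_gt0.
have s20 : 0 <= s2 by apply: Rintegral_ge0 => x _; exact: sqr_ge0.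
have [K K0 HK] := lindeberg_step (e ^+ 2 + s2) e20.
apply/subr_cvg0.
(* The total over [n] steps: for the increment [psi / sqrt n] one step costs the truncated moment
   divided by [n] plus [(s2 / n) ^+ 2], up to the factor [K]. *)
pose B n := K * (Rintegral PX setT (trunc n) + s2 ^+ 2 * n%:R^-1).
suff bd : \forall n \near \oo, `|Rintegral P setT
    (fun w => gauss_cdf 1 ((t - Num.sqrt n%:R * empmean X n psi w) / e))
     - gauss_cdf 1 (t / Num.sqrt (e ^+ 2 + s2))| <= B n.
  have B0 : B n @[n --> \oo] --> (0 : R).
    rewrite -[X in _ --> X](mulr0 K); apply: cvgMl_tmp.
    rewrite -[X in _ --> X](addr0 0); apply: cvgD; first exact: truncated_moment_cvg0.
    rewrite -[X in _ --> X](mulr0 (s2 ^+ 2)); apply: cvgMl_tmp.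
    apply/gtr0_cvgV0; last exact: cvgr_idn.
    by near=> n; rewrite ltr0n; near: n; exact: nbhs_infty_gt.
  apply: (@squeeze_cvgr _ _ _ _ (fun n => - B n) B) => //.
    by apply: filterS bd => n; rewrite ler_norml.
  by rewrite -[X in _ --> X]oppr0; exact: cvgN.
near=> n.
have n0 : (0 < n)%N by near: n; exact: nbhs_infty_gt.
have nR0 : 0 < n%:R :> R by rewrite ltr0n.
pose c := (Num.sqrt (n%:R : R))^-1.
have c2 : c ^+ 2 = n%:R^-1 by rewrite exprVn sqr_sqrtr// ltW.
pose h x := c * psi x.
pose S k w := \sum_(i < k) h (X i w).
(* The smoothing variance plus the share of the [n - k] summands not yet added: [e ^+ 2 + s2] at
   [k = 0] and [e ^+ 2] at [k = n], where the smoothed law of the full sum is recovered. *)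
pose v k : R := e ^+ 2 + s2 * (n - k)%:R / n%:R.
pose A k := Rintegral P setT (fun w => gauss_cdf 1 ((t - S k w) / Num.sqrt (v k))).
have -> : (fun w => gauss_cdf 1 ((t - Num.sqrt n%:R * empmean X n psi w) / e)) =
    (fun w => gauss_cdf 1 ((t - S n w) / Num.sqrt (v n))).
  apply/funext => w; rewrite /v subnn mulr0 mul0r addr0 sqrtr_sqr gtr0_norm//.
  congr (gauss_cdf 1 ((t - _) / e)); rewrite /S /h /empmean -mulr_sumr mulrA.
  congr (_ * _); rewrite -c2 expr2 mulrA divff ?mul1r//.
  by rewrite gt_eqF// sqrtr_gt0.
rewrite -/(A n).
have -> : gauss_cdf 1 (t / Num.sqrt (e ^+ 2 + s2)) = A 0%N.
  rewrite /A /v subn0 mulfK ?gt_eqF//.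
  under eq_Rintegral do rewrite /S big_ord0 subr0.
  by rewrite Rintegral_cst_prob.
have mh : measurable_fun setT h by exact: measurable_funM.
have ih : PX.-integrable setT (EFin \o h) by exact: integrableZ_real.
have h0 : Rintegral PX setT h = 0 by rewrite RintegralZl// psi0 mulr0.
have h2E : (fun x => h x ^+ 2) = (fun x => n%:R^-1 * psi x ^+ 2).
  by apply/funext => x; rewrite /h exprMn c2.
have ih2 : PX.-integrable setT (EFin \o (fun x => h x ^+ 2)).
  by rewrite h2E; exact: integrableZ_real.
have hde : Rintegral PX setT (fun x => h x ^+ 2) = s2 / n%:R.
  by rewrite h2E RintegralZl// mulrC.
have htr : Rintegral PX setT (fun x => h x ^+ 2 * Num.min 1 `|h x|) =
    n%:R^-1 * Rintegral PX setT (trunc n).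
  rewrite -RintegralZl//.
    by apply: eq_Rintegral => x _; rewrite /trunc /h exprMn c2 mulrA.
  apply: (@dominated_integrable_real _ _ _ _ _ (fun x => psi x ^+ 2)) => //.
    apply: measurable_funM => //; first exact: measurable_funX.
    by apply: measurable_minr => //; apply: measurableT_comp.
  by move=> x; exact: min1_bound.
have step k : (k < n)%N -> `|A k.+1 - A k| <= B n / n%:R.
  move=> kn.
  have vE : v k = v k.+1 + s2 / n%:R.
    by rewrite /v -addrA -mulrDl -[in LHS](subnSK kn) -natr1 mulrDr mulr1.
  have vk : e ^+ 2 <= v k.+1 by rewrite lerDl divr_ge0 ?mulr_ge0// ltW.
  have vk' : v k.+1 + s2 / n%:R <= e ^+ 2 + s2.
    rewrite -vE lerD2l ler_pdivrMr// ler_wpM2l// ler_nat leq_subr//.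
  have pS : past_measurable X k (S k) by exact: past_measurable_sum.
  have := HK k (S k) h t (v k.+1) (s2 / n%:R) pS
    mh ih h0 ih2 hde vk vk'.
  rewrite -vE htr -/(A k) => H.
  rewrite (_ : B n / n%:R = K * (n%:R^-1 * Rintegral PX setT (trunc n) + (s2 / n%:R) ^+ 2)).
    have AE : A k.+1 = Rintegral P setT (fun w =>
      gauss_cdf 1 ((t - (S k w + h (X k w))) / Num.sqrt (v k.+1))).
      by rewrite /A; apply: eq_Rintegral => w _; rewrite /S big_ord_recr.
    by rewrite AE; exact: H.
  rewrite /B; move: (Rintegral _ _ _) s2 (n%:R : R) nR0 => I0 s nR nR0'.
  by field; rewrite gt_eqF.
by rewrite (le_trans (telescope_bound step))// mulrC divfK ?gt_eqF.
Unshelve. all: by end_near. Qed.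

End smooth_clt.

(** * Convergence in distribution and in probability *)

Section weak_limits.
Context dO (Omega : measurableType dO) (R : realType)
  (P : probability Omega R).
Implicit Types (W Z U b : nat -> Omega -> R) (t e d v c eta : R).

Lemma fine_prob_le (A B : set Omega) : measurable A -> measurable B ->
  A `<=` B -> fine (P A) <= fine (P B).
Proof. by move=> mA mB AB; rewrite fine_le ?fin_num_measure// le_measure ?inE. Qed.

Lemma fine_prob_leU (A B C : set Omega) : measurable A -> measurable B ->
  measurable C -> A `<=` B `|` C -> fine (P A) <= fine (P B) + fine (P C).
Proof.
move=> mA mB mC ABC; rewrite -lee_fin EFinD !fineK ?fin_num_measure//.
rewrite (le_trans _ (measureU2 _ mB mC))// le_measure ?inE//.
exact: measurableU.
Qed.

Lemma fine_prob_setC (A : set Omega) : measurable A ->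
  fine (P (~` A)) = 1 - fine (P A).
Proof. by move=> mA; rewrite probability_setC// fineB ?fin_num_measure. Qed.

Lemma measurable_le_set (f : Omega -> R) t : measurable_fun setT f ->
  measurable [set w | f w <= t].
Proof.
move=> mf; rewrite (_ : mkset _ = setT `&` f @^-1` `]-oo, t]).
  exact: mf.
by apply/seteqP; split => [w /= wt|w []/= _]; rewrite in_itv.
Qed.

Lemma measurable_gt_norm_set (f : Omega -> R) eta : measurable_fun setT f ->
  measurable [set w | eta < `|f w|].
Proof.
move=> mf; rewrite (_ : mkset _ = ~` [set w | `|f w| <= eta]).
  apply: measurableC; apply: (@measurable_le_set (fun w => `|f w|)).
  exact: measurableT_comp.
by apply/seteqP; split => w /=; rewrite ltNge => /negP.
Qed.

Lemma cvg_inv_at_right0 : d^-1 @[d --> (0 : R)^'+] --> +oo.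
Proof.
apply/gtr0_cvgV0; first by near=> x; rewrite invr_gt0; near: x; exact: nbhs_right_gt.
suff : (d^-1)^-1 @[d --> (0 : R)^'+] --> (0 : R) by [].
by under eq_fun do rewrite invrK; exact: cvg_at_right_filter.
Unshelve. all: by end_near. Qed.

(** Thresholds are shifted by a multiple of [d] while the smoothing has standard deviation [d ^+ 2],
    so a single parameter sends both to 0 with their ratio [d^-1] diverging. The case [v = 0] needs
    [t != 0], the only discontinuity being at 0. *)
Lemma gauss_cdf_smoothing_limit v t c : 0 <= v -> v != 0 \/ t != 0 ->
  gauss_cdf 1 ((t + c * d) / Num.sqrt ((d ^+ 2) ^+ 2 + v)) @[d --> 0^'+]
  --> normal_cdf v t.
Proof.
move=> v0 vt; have did : d @[d --> 0^'+] --> (0 : R) by exact: cvg_at_right_filter.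
have num : t + c * d @[d --> 0^'+] --> t.
  rewrite -[X in _ --> X]addr0; apply: cvgD; first exact: cvg_cst.
  by rewrite -[X in _ --> X](mulr0 c); exact: cvgMl_tmp.
have [v00|v00] := eqVneq v 0; last first.
  have vgt0 : 0 < v by rewrite lt_neqAle eq_sym v00.
  rewrite normal_cdf_gauss//.
  have c1 : {for (t / Num.sqrt v), continuous (gauss_cdf (R:=R) 1)}.
    by apply: gauss_cdf_continuous; exact: oner_neq0.
  apply: (continuous_cvg _ c1); apply: cvgM => //.
  apply: cvgV; first by rewrite gt_eqF ?sqrtr_gt0.
  apply: (continuous_cvg _ (@sqrt_continuous R v)).
  rewrite -[X in _ --> X]add0r; apply: cvgD; last exact: cvg_cst.
  rewrite [X in _ --> X](_ : _ = (0 * 0) * (0 * 0)); last by rewrite !mul0r.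
  by rewrite /=; under eq_fun do rewrite !expr2; apply: cvgM; apply: cvgM.
have t0 : t != 0 by case: vt; rewrite ?v00 ?eqxx.
have tn0 : 0 < `|t| by rewrite normr_gt0.
have dinv := cvg_inv_at_right0.
(* For small [d] the shift uses at most half of [|t|], and [d ^+ 2 <= d]; the argument therefore
   diverges with the sign of [t]. *)
have key : \forall d \near 0^'+, `|t| / 2 * d^-1 <= (`|t| - `|c| * d) / Num.sqrt ((d ^+ 2) ^+ 2 + v).
  near=> d; have d0 : 0 < d by near: d; exact: nbhs_right_gt.
  have d1 : d <= 1 by near: d; exact: nbhs_right_le.
  have cd : `|c| * d <= `|t| / 2.
    have : d <= `|t| / 2 / (`|c| + 1).
      by near: d; apply: nbhs_right_le; rewrite !divr_gt0// ltr_wpDl.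
    rewrite ler_pdivlMr ?ltr_wpDl// mulrDr mulr1 mulrC; lra.
  rewrite v00 addr0 sqrtr_sqr (ger0_norm (sqr_ge0 d)).
  apply: ler_pM; rewrite ?invr_ge0 ?divr_ge0 ?(ltW d0)//; first lra.
  by rewrite lef_pV2 ?posrE ?exprn_gt0// expr2 ler_piMl// ltW.
rewrite /normal_cdf v00 eqxx; move: t0; rewrite neq_lt => /orP[tneg|tpos].
  rewrite leNgt tneg /=; rewrite ltr0_norm// in key.
  apply: (@squeeze_cvgr _ _ _ _ (cst 0) (fun d => gauss_cdf 1 (t / 2 * d^-1))).
  - near=> d; rewrite gauss_cdf_ge0/= gauss_cdf_nondecreasing//.
    have d0 : 0 < d by near: d; exact: nbhs_right_gt.
    have h : - t / 2 * d^-1 <= (- t - `|c| * d) / Num.sqrt ((d ^+ 2) ^+ 2 + v).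
      by near: d.
    have cd : c * d <= `|c| * d by rewrite ler_wpM2r ?(ltW d0)// ler_norm.
    have s0 : 0 <= (Num.sqrt ((d ^+ 2) ^+ 2 + v))^-1 by rewrite invr_ge0.
    have := ler_wpM2r s0 cd; rewrite -v00; move: h; rewrite !mulrDl !mulNr; lra.
  - exact: cvg_cst.
  - apply: (cvg_comp _ _ _ (gauss_cdf_cvgNy 1)).
    have -> : (fun d : R => t / 2 * d^-1) = (fun d => - (- t / 2 * d^-1)).
      by apply/funext => d; rewrite mulNr mulNr opprK.
    by apply/cvgNrNy; apply: gt0_cvgMry => //; rewrite divr_gt0// oppr_gt0.
rewrite (ltW tpos); rewrite gtr0_norm// in key.
apply: (@squeeze_cvgr _ _ _ _ (fun d => gauss_cdf 1 (t / 2 * d^-1)) (cst 1)).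
- near=> d; rewrite gauss_cdf_le1 andbT gauss_cdf_nondecreasing//.
  have d0 : 0 < d by near: d; exact: nbhs_right_gt.
  have h : t / 2 * d^-1 <= (t - `|c| * d) / Num.sqrt ((d ^+ 2) ^+ 2 + v).
    by near: d.
  have cd : - (c * d) <= `|c| * d by rewrite -mulNr -normrN ler_wpM2r ?(ltW d0)// ler_norm.
  have s0 : 0 <= (Num.sqrt ((d ^+ 2) ^+ 2 + v))^-1 by rewrite invr_ge0.
  have := ler_wpM2r s0 cd; rewrite -v00; move: h; rewrite !mulrDl !mulNr; lra.
- apply: (cvg_comp _ _ _ (gauss_cdf_cvgy 1)).
  by apply: gt0_cvgMry => //; rewrite divr_gt0.
- exact: cvg_cst.
Unshelve. all: by end_near. Qed.

Let E (f : Omega -> R) := Rintegral P setT f.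

Lemma indic_integrable (A : set Omega) : measurable A ->
  P.-integrable setT (EFin \o (\1_A : Omega -> R)).
Proof.
move=> mA; apply: (@bounded_integrable _ _ _ _ _ 1) => //.
by move=> w; rewrite indicE; case: (_ \in _); rewrite ?normr1 ?normr0.
Qed.

Lemma Rintegral_indic_prob (A : set Omega) : measurable A ->
  Rintegral P setT (\1_A : Omega -> R) = fine (P A).
Proof. by move=> mA; rewrite /Rintegral integral_indic// setIT. Qed.

(** On the event the argument is at least [d^-1], so the smoothed indicator misses 1 by at most the
    added constant; off the event nonnegativity suffices. *)
Lemma smoothed_upper (f : Omega -> R) t d : 0 < d -> measurable_fun setT f ->
  fine (P [set w | f w <= t]) <=
  E (fun w => gauss_cdf 1 ((t + d - f w) / d ^+ 2)) + (1 - gauss_cdf 1 d^-1).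
Proof.
move=> d0 mf; have mA := measurable_le_set t mf.
have iG := integrable_gauss_cdf_comp P (t + d) (d ^+ 2)^-1 mf.
have ic : P.-integrable setT (EFin \o (fun=> 1 - gauss_cdf 1 d^-1)).
  exact: integrable_cst_prob.
rewrite -Rintegral_indic_prob// -[X in _ + X](Rintegral_cst_prob P) -RintegralD//.
apply: le_Rintegral => //; [exact: indic_integrable|exact: integrableD_real|].
move=> w _; have [/set_mem/= wt|_] := boolP (w \in _).
  rewrite mulr1n addrCA lerDl subr_ge0 gauss_cdf_nondecreasing//.
  by rewrite ler_pdivlMr ?exprn_gt0// expr2 mulKf ?gt_eqF//; lra.
by rewrite mulr0n addr_ge0 ?gauss_cdf_ge0// subr_ge0 gauss_cdf_le1.
Qed.

(** Off the event the argument is at most [- d^-1], so the subtracted constant absorbs the smoothed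
    indicator there. *)
Lemma smoothed_lower (f : Omega -> R) t d : 0 < d -> measurable_fun setT f ->
  E (fun w => gauss_cdf 1 ((t - d - f w) / d ^+ 2)) - gauss_cdf 1 (- d^-1) <=
  fine (P [set w | f w <= t]).
Proof.
move=> d0 mf; have mA := measurable_le_set t mf.
have iG := integrable_gauss_cdf_comp P (t - d) (d ^+ 2)^-1 mf.
have ic : P.-integrable setT (EFin \o (fun=> gauss_cdf 1 (- d^-1))).
  exact: integrable_cst_prob.
rewrite -Rintegral_indic_prob// -[X in _ - X](Rintegral_cst_prob P) -RintegralB//.
apply: le_Rintegral => //; [exact: integrableB_real|exact: indic_integrable|].
move=> w _; have [_|] := boolP (w \in _).
  rewrite mulr1n lerBlDr (le_trans (gauss_cdf_le1 _ _))// lerDl.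
  exact: gauss_cdf_ge0.
rewrite notin_setE /= => /negP; rewrite -ltNge => wt.
rewrite mulr0n subr_le0 gauss_cdf_nondecreasing//.
rewrite ler_pdivrMr ?exprn_gt0//.
have -> : - d^-1 * d ^+ 2 = - d by field; rewrite gt_eqF.
by lra.
Qed.

(** Each side of the sandwich meets three of the six errors, hence the thirds. *)
Lemma sandwich_arith (L p a1 a2 b1 b2 q1 q0 x : R) :
  `|L - a1| <= x / 3 -> `|L - a2| <= x / 3 -> `|1 - q1| <= x / 3 ->
  `|0 - q0| <= x / 3 -> `|a2 - b2| <= x / 3 -> `|a1 - b1| <= x / 3 ->
  b2 - q0 <= p -> p <= b1 + (1 - q1) -> `|L - p| <= x.
Proof.
by rewrite !ler_norml => /andP[? ?] /andP[? ?] /andP[? ?] /andP[? ?] /andP[? ?]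
  /andP[? ?] ? ?; apply/andP; split; lra.
Qed.

Lemma smoothed_cvg_dist W v : 0 <= v ->
  (forall n, measurable_fun setT (W n)) ->
  (forall e t, 0 < e -> E (fun w => gauss_cdf 1 ((t - W n w) / e)) @[n --> \oo]
     --> gauss_cdf 1 (t / Num.sqrt (e ^+ 2 + v))) ->
  cvg_dist_normal P W v.
Proof.
move=> v0 mW HW t vt; apply/cvgrPdist_le => eta eta0.
have e3 : 0 < eta / 3 by rewrite divr_gt0.
have dinv := cvg_inv_at_right0.
have /cvgrPdist_le/(_ _ e3) nu := gauss_cdf_smoothing_limit 1 v0 vt.
have /cvgrPdist_le/(_ _ e3) nl := gauss_cdf_smoothing_limit (-1) v0 vt.
have /cvgrPdist_le/(_ _ e3) n1 := cvg_comp _ _ dinv (@gauss_cdf_cvgy R 1).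
have dinvN : - d^-1 @[d --> 0^'+] --> (-oo : set_system R) by exact/cvgNrNy.
have /cvgrPdist_le/(_ _ e3) n0 := cvg_comp _ _ dinvN (@gauss_cdf_cvgNy R 1).
(* One [d] satisfying all four estimates is fixed before [n] grows; the hypothesis is then used only
   at smoothing scale [d ^+ 2] and thresholds [t + d], [t - d]. *)
have := @filter_ex _ _ (at_right_proper_filter 0) _ (filterI (nbhs_right_gt 0)
  (filterI (filterI nu nl) (filterI n1 n0))).
move=> [d [d0 [[hu hl] [h1 h0]]]].
rewrite mul1r in hu; rewrite mulN1r in hl.
have d20 : 0 < d ^+ 2 by rewrite exprn_gt0.
have /cvgrPdist_le/(_ _ e3) mu := HW _ (t + d) d20.
have /cvgrPdist_le/(_ _ e3) ml := HW _ (t - d) d20.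
apply: filterS2 mu ml => n hmu hml.
exact: (sandwich_arith hu hl h1 h0 hml hmu
  (smoothed_lower t d0 (mW n)) (smoothed_upper t d0 (mW n))).
Qed.

End weak_limits.

(** * Convergence to 0 in probability, tightness and Slutsky's lemma *)

Section slutsky.
Context dO (Omega : measurableType dO) (R : realType)
  (P : probability Omega R).
Implicit Types (W Z U b Y : nat -> Omega -> R) (t e d v c eta : R).

(** [op_sqrt P Y] unfolds to this property for [Num.sqrt n%:R * Y n]. *)
Definition cvg_pr0 Y := forall eta, 0 < eta ->
  fine (P [set w | eta < `|Y n w|]) @[n --> \oo] --> (0 : R).

Definition tight W := forall eta, 0 < eta -> exists2 K : R, 0 < K &
  \forall n \near \oo, fine (P [set w | K < `|W n w|]) <= eta.

Lemma prob_cvg0P (p : nat -> R) : (forall n, 0 <= p n) ->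
  (forall x, 0 < x -> \forall n \near \oo, p n <= x) -> p n @[n --> \oo] --> (0 : R).
Proof.
move=> p0 px; apply/cvgrPdist_le => x /px; apply: filterS => n.
by rewrite sub0r normrN ger0_norm.
Qed.

Lemma cvg_pr0_near Y eta x : cvg_pr0 Y -> 0 < eta -> 0 < x ->
  \forall n \near \oo, fine (P [set w | eta < `|Y n w|]) <= x.
Proof.
move=> hY eta0 x0; have /cvgrPdist_le/(_ _ x0) := hY _ eta0.
by apply: filterS => n; rewrite sub0r normrN ger0_norm ?fine_ge0.
Qed.

Lemma cvg_pr0_0 : cvg_pr0 (fun _ _ => 0).
Proof.
move=> eta eta0; rewrite (_ : (fun n => _) = (fun=> 0)); first exact: cvg_cst.
apply/funext => n; rewrite (_ : mkset _ = set0) ?measure0//.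
by apply/seteqP; split => // w /=; rewrite normr0 ltNge ltW.
Qed.

Lemma cvg_pr0Z Y c : cvg_pr0 Y -> cvg_pr0 (fun n w => c * Y n w).
Proof.
have [->|c0] := eqVneq c 0.
  rewrite (_ : (fun n w => 0 * Y n w) = (fun _ _ => 0)) => [_|].
    exact: cvg_pr0_0.
  by apply/funext => n; apply/funext => w; rewrite mul0r.
move=> hY eta eta0.
have c0' : 0 < `|c| by rewrite normr_gt0.
have := hY (eta / `|c|); rewrite divr_gt0// => /(_ isT).
rewrite (_ : (fun n => fine (P [set w | eta / `|c| < _])) =
  (fun n => fine (P [set w | eta < `|c * Y n w|])))//.
apply/funext => n; congr (fine (P _)); apply/seteqP; split => w /=;
  by rewrite normrM ltr_pdivrMr// mulrC.
Qed.

Lemma cvg_pr0D Y Z : (forall n, measurable_fun setT (Y n)) ->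
  (forall n, measurable_fun setT (Z n)) ->
  cvg_pr0 Y -> cvg_pr0 Z -> cvg_pr0 (fun n w => Y n w + Z n w).
Proof.
move=> mY mZ hY hZ eta eta0; have eta2 : 0 < eta / 2 by rewrite divr_gt0.
apply: prob_cvg0P => [n|x x0]; first by rewrite fine_ge0.
have x2 : 0 < x / 2 by rewrite divr_gt0.
have nY := cvg_pr0_near hY eta2 x2; have nZ := cvg_pr0_near hZ eta2 x2.
apply: filterS2 nY nZ => n nY nZ; rewrite [leRHS](_ : x = x / 2 + x / 2); last by field.
apply: (le_trans _ (lerD nY nZ)); apply: fine_prob_leU.
- by apply: measurable_gt_norm_set; exact: measurable_funD.
- exact: measurable_gt_norm_set.
- exact: measurable_gt_norm_set.
move=> w /= h; have [h1|h1] := ltP (eta / 2) `|Y n w|; first by left.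
by right; have := ler_normD (Y n w) (Z n w); lra.
Qed.

Lemma cvg_pr0_sum (I : Type) (r : seq I) (Y : I -> nat -> Omega -> R) :
  (forall i n, measurable_fun setT (Y i n)) -> (forall i, cvg_pr0 (Y i)) ->
  cvg_pr0 (fun n w => \sum_(i <- r) Y i n w).
Proof.
move=> mY hY; elim: r => [|i r IH].
  under [X in cvg_pr0 X]eq_fun do under eq_fun do rewrite big_nil.
  exact: cvg_pr0_0.
under [X in cvg_pr0 X]eq_fun do under eq_fun do rewrite big_cons.
by apply: cvg_pr0D => // n; exact: measurable_sum.
Qed.

Lemma tight_scaled_cvg_pr0 W (c : nat -> R) : (forall n, measurable_fun setT (W n)) ->
  tight W -> c n @[n --> \oo] --> (0 : R) -> cvg_pr0 (fun n w => c n * W n w).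
Proof.
move=> mW tW c0 eta eta0; apply: prob_cvg0P => [n|x x0]; first by rewrite fine_ge0.
have [K K0 nK] := tW _ x0.
have /cvgrPdist_le/(_ (eta / K)) := c0; rewrite divr_gt0// => /(_ isT) nc.
apply: filterS2 nK nc => n nK; rewrite sub0r normrN => nc.
apply: (le_trans _ nK); apply: fine_prob_le.
- by apply: measurable_gt_norm_set; exact: measurable_funM.
- exact: measurable_gt_norm_set.
move=> w /=; rewrite normrM => h; rewrite ltNge; apply/negP => WK.
have := ler_pM (normr_ge0 _) (normr_ge0 _) nc WK.
by rewrite divfK ?gt_eqF// leNgt h.
Qed.

(** The bound on [Y] is demanded only where [b] is at most 1/2 in absolute value. This has
    probability tending to 1 and keeps a denominator [1 + b] away from 0; elsewhere [Y] is
    arbitrary. *)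
Lemma ratio_remainder_cvg_pr0 W U b Y :
  (forall n, measurable_fun setT (W n)) -> (forall n, measurable_fun setT (U n)) ->
  (forall n, measurable_fun setT (b n)) -> (forall n, measurable_fun setT (Y n)) ->
  tight W -> cvg_pr0 U -> cvg_pr0 b ->
  (\forall n \near \oo, forall w, `|b n w| <= 2^-1 ->
     `|Y n w| <= 2 * (`|U n w| + `|b n w| * `|W n w|)) ->
  cvg_pr0 Y.
Proof.
move=> mW mU mb mY tW hU hb hY eta eta0.
apply: prob_cvg0P => [n|x x0]; first by rewrite fine_ge0.
have x3 : 0 < x / 3 by rewrite divr_gt0.
have [K K0 nK] := tW _ x3.
(* Outside the three exceptional events both [|U|] and [|b| * |W|] are at most [eta / 4], so
   [|Y| <= eta]. *)
pose rho := Num.min 2^-1 (eta / 4 / K).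
have rho0 : 0 < rho by rewrite lt_min invr_gt0 ltr0n /= !divr_gt0.
have eta4 : 0 < eta / 4 by rewrite divr_gt0.
have nU := cvg_pr0_near hU eta4 x3.
have nb := cvg_pr0_near hb rho0 x3.
apply: filterS2 (filterI nK nU) (filterI nb hY) => n [nK' nU'] [nb' hY'].
rewrite [leRHS](_ : x = x / 3 + (x / 3 + x / 3)); last by field.
apply: (le_trans _ (lerD nK' (lerD nU' nb'))).
have mA := measurable_gt_norm_set.
apply: (le_trans (@fine_prob_leU _ _ _ P _ [set w | K < `|W n w|]
  ([set w | eta / 4 < `|U n w|] `|` [set w | rho < `|b n w|]) _ _ _ _)).
- exact: mA.
- exact: mA.
- by apply: measurableU; exact: mA.
- move=> w /= h; have [h1|h1] := ltP K `|W n w|; first by left.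
  right; have [h2|h2] := ltP (eta / 4) `|U n w|; first by left.
  right; rewrite ltNge; apply/negP; rewrite le_min => /andP[h3 h4].
  have := hY' w h3; have := ler_pM (normr_ge0 _) (normr_ge0 _) h4 h1.
  by rewrite divfK ?gt_eqF//; lra.
rewrite lerD2l; apply: fine_prob_leU => //; try exact: mA.
by apply: measurableU; exact: mA.
Qed.

Let E (f : Omega -> R) := Rintegral P setT f.

Lemma gauss_cdf_lipschitz (x y : R) :
  `|gauss_cdf 1 x - gauss_cdf 1 y| <= normal_peak 1 * `|x - y|.
Proof.
have [c [_ _ ->]] := mvt_between y x
  (fun x => is_derive_gauss_cdf x (oner_neq0 R)).
rewrite normrM ler_wpM2r// ger0_norm ?gauss_pdf_ge0//.
by apply: normal_pdf_ub; exact: oner_neq0.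
Qed.

(** Where [Y] is small the Lipschitz bound controls the difference; elsewhere the difference is at
    most 1, on an event of small probability. *)
Lemma smoothed_slutsky W Y e t (l : R) : 0 < e ->
  (forall n, measurable_fun setT (W n)) -> (forall n, measurable_fun setT (Y n)) ->
  cvg_pr0 Y ->
  E (fun w => gauss_cdf 1 ((t - W n w) / e)) @[n --> \oo] --> l ->
  E (fun w => gauss_cdf 1 ((t - (W n w + Y n w)) / e)) @[n --> \oo] --> l.
Proof.
move=> e0 mW mY hY hW.
pose p : R := normal_peak 1; have p0 : 0 < p by apply: normal_peak_gt0; exact: oner_neq0.
have iW n : P.-integrable setT (EFin \o (fun w => gauss_cdf 1 ((t - W n w) / e))).
  exact: integrable_gauss_cdf_comp.
have iZ n : P.-integrable setT (EFin \o (fun w => gauss_cdf 1 ((t - (W n w + Y n w)) / e))).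
  apply: (@integrable_gauss_cdf_comp _ _ _ P (fun w => W n w + Y n w)).
  exact: measurable_funD.
suff h : E (fun w => gauss_cdf 1 ((t - (W n w + Y n w)) / e))
    - E (fun w => gauss_cdf 1 ((t - W n w) / e)) @[n --> \oo] --> (0 : R).
  rewrite -[l]add0r; apply: cvg_trans (cvgD h hW); apply: near_eq_cvg.
  by apply: nearW => n; rewrite /= subrK.
apply/cvgrPdist_le => x x0; have x2 : 0 < x / 2 by rewrite divr_gt0.
(* Chosen so that the Lipschitz constant [p / e] times [del] equals [x / 2]. *)
pose del := e * (x / 2) / p.
have del0 : 0 < del by rewrite divr_gt0// mulr_gt0.
have nY := cvg_pr0_near hY del0 x2.
apply: filterS nY => n nY; rewrite sub0r normrN -RintegralB//.
have iD : P.-integrable setT (EFin \o (fun w => gauss_cdf 1 ((t - (W n w + Y n w)) / e)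
    - gauss_cdf 1 ((t - W n w) / e))) by exact: integrableB_real.
apply: (le_trans (le_normr_Rintegral _ iD)) => //.
pose A := [set w | del < `|Y n w|].
have mA : measurable A by exact: measurable_gt_norm_set.
have iA := indic_integrable P mA.
have ic : P.-integrable setT (EFin \o (fun=> x / 2)).
  exact: integrable_cst_prob.
apply: (@le_trans _ _ (E (fun w => x / 2 + (\1_A w : R)))).
  apply: le_Rintegral => //; [exact: (integrable_norm iD)|exact: integrableD_real|].
  move=> w _; have [wA|] := boolP (w \in A).
    rewrite indicE wA mulr1n -[leLHS]add0r lerD ?(ltW x2)//.
    rewrite ler_norml; apply/andP; split.
      by have := gauss_cdf_le1 1 ((t - W n w) / e);
         have := gauss_cdf_ge0 1 ((t - (W n w + Y n w)) / e); lra.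
    by have := gauss_cdf_ge0 1 ((t - W n w) / e);
       have := gauss_cdf_le1 1 ((t - (W n w + Y n w)) / e); lra.
  move=> wA; rewrite indicE (negbTE wA) mulr0n addr0.
  move: wA; rewrite notin_setE /A /= => /negP; rewrite -leNgt => wA.
  apply: (le_trans (gauss_cdf_lipschitz _ _)).
  rewrite (_ : _ - _ = - (Y n w / e)); last by ring.
  rewrite normrN normrM (gtr0_norm (x := e^-1)) ?invr_gt0//.
  rewrite mulrA ler_pdivrMr// mulrC -ler_pdivlMr//.
  by rewrite [x / 2 * e]mulrC.
rewrite /E RintegralD// Rintegral_cst_prob Rintegral_indic_prob//.
by rewrite [leRHS](_ : x = x / 2 + x / 2); [rewrite lerD2l|field].
Qed.

Lemma normal_cdf_limits v eta : 0 <= v -> 0 < eta -> exists2 K : R, 0 < K &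
  1 - eta <= normal_cdf v K /\ normal_cdf v (- K) <= eta.
Proof.
move=> v0 eta0; have [v00|v00] := eqVneq v 0.
  exists 1 => //; rewrite /normal_cdf v00 eqxx ler01.
  have -> : (0 <= -1 :> R) = false by apply/negbTE; rewrite -ltNge ltrN10.
  by rewrite (ltW eta0); split => //; lra.
have vgt0 : 0 < v by rewrite lt_neqAle eq_sym v00.
have /cvgrPdist_le/(_ _ eta0) hy := @gauss_cdf_cvgy R 1.
have xN : - x @[x --> +oo] --> (-oo : set_system R) by exact/cvgNrNy.
have /cvgrPdist_le/(_ _ eta0) hN := cvg_comp _ _ xN (@gauss_cdf_cvgNy R 1).
near (+oo : set_system R) => x.
have x0 : 0 < x by near: x; exact: nbhs_pinfty_gt.
have s0 : 0 < Num.sqrt v by rewrite sqrtr_gt0.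
have h1 : `|1 - gauss_cdf 1 x| <= eta by near: x.
have h2 : `|0 - gauss_cdf 1 (- x)| <= eta by near: x.
exists (x * Num.sqrt v); first exact: mulr_gt0.
rewrite !normal_cdf_gauss// -mulNr !mulfK ?gt_eqF//.
by move: h1 h2; rewrite !ler_norml => /andP[? ?] /andP[? ?]; split; lra.
Unshelve. all: by end_near. Qed.

(** Convergence is used only at [K] and [- K]; being nonzero, these are continuity points of the
    limit even when [v = 0]. *)
Lemma cvg_dist_normal_tight W v : 0 <= v -> (forall n, measurable_fun setT (W n)) ->
  cvg_dist_normal P W v -> tight W.
Proof.
move=> v0 mW hW eta eta0; have eta4 : 0 < eta / 4 by rewrite divr_gt0.
have [K K0 [hK hNK]] := normal_cdf_limits v0 eta4.
have /cvgrPdist_le/(_ _ eta4) n1 := hW K (or_intror (lt0r_neq0 K0)).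
have NK0 : - K != 0 by rewrite oppr_eq0 gt_eqF.
have /cvgrPdist_le/(_ _ eta4) n2 := hW (- K) (or_intror NK0).
exists K => //; apply: filterS2 n1 n2 => n.
rewrite !ler_norml => /andP[? ?] /andP[? ?].
have m1 := measurable_le_set K (mW n).
have m2 := measurable_le_set (- K) (mW n).
have := fine_prob_leU P
  (measurable_gt_norm_set K (mW n)) (measurableC m1) m2.
rewrite fine_prob_setC//; set q := fine (P (mkset _)) => hq.
suff : q <= 1 - fine (P [set w | W n w <= K]) + fine (P [set w | W n w <= - K]) by lra.
apply: hq => w /= h; have [h1|h1] := ltP K (W n w); first by left.
right; move: h; case: (ltrP (W n w) 0) => h2.
  by rewrite ltr0_norm//; lra.
by rewrite ger0_norm//; lra.
Qed.

End slutsky.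

(** * The central limit theorem *)

Section square_integrable.
Context d (T : measurableType d) (R : realType) (P : probability T R).
Implicit Types (f g : T -> R) (c : R).

Definition square_integrable f :=
  measurable_fun setT f /\ P.-integrable setT (EFin \o (fun x => f x ^+ 2)).

Lemma square_integrable_integrable f : square_integrable f ->
  P.-integrable setT (EFin \o f).
Proof.
move=> [mf f2]; apply: (@dominated_integrable_real _ _ _ _ _ (fun x => 1 + f x ^+ 2)) => //.
  move=> x; rewrite -[f x ^+ 2]real_normK ?num_real//.
  by have := sqr_ge0 (`|f x| - 2^-1); rewrite !expr2; nra.
by apply: integrableD_real => //; exact: integrable_cst_prob.
Qed.

Lemma square_integrable_cst c : square_integrable (fun=> c).
Proof. by split => //; exact: integrable_cst_prob. Qed.

Lemma square_integrableZ c f : square_integrable f ->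
  square_integrable (fun x => c * f x).
Proof.
move=> [mf f2]; split; first exact: measurable_funM.
by under eq_fun do rewrite exprMn; exact: integrableZ_real.
Qed.

Lemma square_integrableD f g : square_integrable f -> square_integrable g ->
  square_integrable (fun x => f x + g x).
Proof.
move=> [mf f2] [mg g2]; split; first exact: measurable_funD.
apply: (@dominated_integrable_real _ _ _ _ _ (fun x => 2 * f x ^+ 2 + 2 * g x ^+ 2)).
- by apply: measurable_funX; exact: measurable_funD.
- move=> x; rewrite ger0_norm ?sqr_ge0//.
  by have := sqr_ge0 (f x - g x); rewrite !expr2; lra.
- by apply: integrableD_real; exact: integrableZ_real.
Qed.

Lemma square_integrableB f g : square_integrable f -> square_integrable g ->
  square_integrable (fun x => f x - g x).
Proof.
move=> hf hg; under eq_fun do rewrite -mulN1r.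
by apply: square_integrableD => //; exact: square_integrableZ.
Qed.

Lemma square_integrable_sum (I : Type) (r : seq I) (f : I -> T -> R) :
  (forall i, square_integrable (f i)) ->
  square_integrable (fun x => \sum_(i <- r) f i x).
Proof.
move=> hf; elim: r => [|i r IH].
  by under eq_fun do rewrite big_nil; exact: square_integrable_cst.
by under eq_fun do rewrite big_cons; exact: square_integrableD.
Qed.

Lemma Rintegral_sum_square_integrable (I : Type) (r : seq I) (f : I -> T -> R) :
  (forall i, square_integrable (f i)) ->
  Rintegral P setT (fun x => \sum_(i <- r) f i x) =
  \sum_(i <- r) Rintegral P setT (f i).
Proof.
move=> hf; elim: r => [|i r IH].
  by rewrite big_nil; under eq_Rintegral do rewrite big_nil; rewrite Rintegral_cst_prob.
rewrite big_cons -IH; under eq_Rintegral do rewrite big_cons.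
rewrite RintegralD//; apply: square_integrable_integrable => //.
exact: square_integrable_sum.
Qed.

(** A square is at most 1 where [|f x| <= 1], and at most the power [2 + e] elsewhere. *)
Lemma moment_square_integrable f (e B : R) : measurable_fun setT f -> 0 < e ->
  (\int[P]_x ((`| f x | `^ (2 + e))%:E) <= B%:E)%E -> square_integrable f.
Proof.
move=> mf e0 fB; split => //.
have mp : measurable_fun setT (fun x => `|f x| `^ (2 + e)).
  apply: (measurableT_comp (measurable_powR (2 + e))).
  exact: measurableT_comp.
apply: (@dominated_integrable_real _ _ _ _ _ (fun x => 1 + `|f x| `^ (2 + e))).
- exact: measurable_funX.
- move=> x; rewrite ger0_norm ?sqr_ge0// -[f x ^+ 2]real_normK ?num_real//.
  have [f1|f1] := leP `|f x| 1.
    by rewrite (@le_trans _ _ 1) ?exprn_ile1// lerDl powR_ge0.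
  rewrite -powR_mulrn// ler_wpDl// ler_powR ?(ltW f1)//; lra.
- apply: integrableD_real; first exact: integrable_cst_prob.
  apply/integrableP; split; first exact/measurable_EFinP.
  apply: le_lt_trans (ltry B); apply: le_trans fB.
  by apply: ge0_le_integral => //; [exact/measurableT_comp/measurable_EFinP|
    exact/measurable_EFinP|move=> x _ /=; rewrite ger0_norm ?powR_ge0].
Qed.

End square_integrable.

(** Reduces inversion to a power function through [y^-1 = y * (y ^+ 2)^-1], which also holds at 0
    since [0^-1 = 0]. *)
Lemma measurable_funV_real d (T : measurableType d) (R : realType) (f : T -> R) :
  measurable_fun setT f -> measurable_fun setT (fun x => (f x)^-1).
Proof.
move=> mf; rewrite (_ : (fun x => _) = (fun x => f x * (f x ^+ 2) `^ (-1))).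
  apply: measurable_funM => //; apply: (measurableT_comp (measurable_powR (-1))).
  exact: measurable_funX.
apply/funext => x; rewrite powR_inv1 ?sqr_ge0//.
have [->|f0] := eqVneq (f x) 0; first by rewrite invr0 mul0r.
by field.
Qed.

Section empirical_mean.
Context {R : realType} {Omega Xt : Type} (X : nat -> Omega -> Xt).
Implicit Types (f g : Xt -> R) (c : R) (n : nat).

Lemma empmeanZ n c f w : empmean X n (fun x => c * f x) w = c * empmean X n f w.
Proof. by rewrite /empmean -mulr_sumr mulrCA. Qed.

Lemma empmeanB n f g w :
  empmean X n (fun x => f x - g x) w = empmean X n f w - empmean X n g w.
Proof. by rewrite /empmean sumrB mulrBr. Qed.

Lemma empmean_cst n c w : (0 < n)%N -> empmean X n (fun=> c) w = c.
Proof.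
move=> n0; rewrite /empmean sumr_const card_ord -[c *+ n]mulr_natl mulKf//.
by rewrite pnatr_eq0 -lt0n.
Qed.

Lemma empmean_sum n (I : Type) (r : seq I) (f : I -> Xt -> R) w :
  empmean X n (fun x => \sum_(i <- r) f i x) w =
  \sum_(i <- r) empmean X n (f i) w.
Proof. by rewrite /empmean exchange_big/= mulr_sumr. Qed.

End empirical_mean.

Section iid_clt.
Context dO dX (Omega : measurableType dO) (Xt : measurableType dX)
  (R : realType).
Variables (P : probability Omega R) (PX : probability Xt R)
  (X : nat -> Omega -> Xt).
Hypothesis hX : iid_seq P X PX.

Lemma measurable_empmean n (h : Xt -> R) : measurable_fun setT h ->
  measurable_fun setT (empmean X n h).
Proof.
move=> mh; have [mX _ _] := hX; apply: measurable_funM => //.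
by apply: measurable_sum => i; exact: measurableT_comp.
Qed.

(** Serves to obtain tightness in [iid_tight]; the ratio itself is treated through [smooth_clt]. *)
Lemma iid_clt (h : Xt -> R) : square_integrable PX h -> Rintegral PX setT h = 0 ->
  cvg_dist_normal P (fun n w => Num.sqrt n%:R * empmean X n h w)
    (Rintegral PX setT (fun x => h x ^+ 2)).
Proof.
move=> hh h0; have [mh h2] := hh.
have ih := square_integrable_integrable hh.
apply: smoothed_cvg_dist.
- by apply: Rintegral_ge0 => x _; exact: sqr_ge0.
- by move=> n; apply: measurable_funM => //; exact: measurable_empmean.
- by move=> e t e0; exact: smooth_clt.
Qed.

Lemma iid_tight (h : Xt -> R) : square_integrable PX h -> Rintegral PX setT h = 0 ->
  tight P (fun n w => Num.sqrt n%:R * empmean X n h w).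
Proof.
move=> hh h0; apply: cvg_dist_normal_tight (iid_clt hh h0).
- by apply: Rintegral_ge0 => x _; exact: sqr_ge0.
- by move=> n; apply: measurable_funM => //; apply: measurable_empmean; case: hh.
Qed.

(** A weak law of large numbers: the mean is a tight sequence times [(Num.sqrt n%:R)^-1]. At [n = 0]
    the factorization holds because both sides are 0. *)
Lemma empmean_cvg_pr0 (h : Xt -> R) : square_integrable PX h ->
  Rintegral PX setT h = 0 -> cvg_pr0 P (fun n w => empmean X n h w).
Proof.
move=> hh h0.
rewrite (_ : (fun n w => _) = (fun n w => (Num.sqrt n%:R)^-1 *
    (Num.sqrt n%:R * empmean X n h w))); last first.
  apply/funext => -[|n]; apply/funext => w.
    by rewrite /empmean big_ord0 !mulr0.
  by rewrite mulKf// gt_eqF// sqrtr_gt0.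
apply: tight_scaled_cvg_pr0; [|exact: iid_tight|exact: inv_sqrt_cvg0].
by move=> n; apply: measurable_funM => //; apply: measurable_empmean; case: hh.
Qed.

End iid_clt.

(** An exact form of the delta method for a ratio: [e1] is the linear part of the numerator error,
    [e2] its remainder, [b] the relative error of the denominator and [q] the normalization. The
    subtracted term is the linearization, and it reappears on the right multiplied by the small
    [b]. *)
Lemma ratio_expansion (R : fieldType) (q mu r e1 e2 b : R) :
  mu != 0 -> 1 + b != 0 ->
  q * ((r * mu + e1 + e2) / (mu * (1 + b)) - r)
    - mu^-1 * (q * (e1 - r * (mu * b))) =
  (mu^-1 * (q * e2) - b * (mu^-1 * (q * (e1 - r * (mu * b))))) / (1 + b).
Proof. by move=> mu0 b0; field; rewrite b0 mu0. Qed.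

Theorem theorem1
  (R : realType)
  (dX : measure_display) (Xt : measurableType dX) (PX : probability Xt R)
  (dF : measure_display) (F : measurableType dF) (lam : probability F R)
  (Rule : Type) (d : Rule -> F -> R)
  (Theta : Type) (fth : Theta -> Rule) (fbase : Rule)
  (g : Xt -> Theta -> F -> R) (gbase : Xt -> F -> R)
  (phi1 : Xt -> F -> R)
  (dO : measure_display) (Omega : measurableType dO) (P : probability Omega R)
  (X : nat -> Omega -> Xt)
  (G : set F)
  (* G : the set of f for which the a.e. assumptions hold; lam-a.e. f lies in G *)
  (hG : lam.-negligible (~` G))
  (* measurability of g, g_base *)
  (hgm : forall th f, measurable_fun setT (fun x => g x th f))
  (hgbm : forall f, measurable_fun setT (fun x => gbase x f))
  (* (2 + eps)-moment bounds *)
  (heps : exists eps : R, 0 < eps /\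
     (exists B : R, forall th f,
        (\int[PX]_x ((`| g x th f | `^ (2 + eps))%:E) <= B%:E)%E) /\
     (exists B : R, forall f,
        (\int[PX]_x ((`| gbase x f | `^ (2 + eps))%:E) <= B%:E)%E))
  (* integral representations of the discrepancies, for a.e. f *)
  (hd : forall f, G f -> forall th, d (fth th) f = Rintegral PX setT (fun x => g x th f))
  (hdb : forall f, G f -> d fbase f = Rintegral PX setT (fun x => gbase x f))
  (* i.i.d. sample *)
  (hX : iid_seq P X PX)
  (* measurability of the empirical model discrepancy d_n(F_Theta, f) *)
  (hdnm : forall f, G f -> forall n : nat,
     measurable_fun setT
       (fun w => inf [set empmean X n (fun x => g x th f) w | th in [set: Theta]]))
  (* asymptotic linearity, for a.e. f *)
  (hphi : forall f, G f ->
     [/\ measurable_fun setT (fun x => phi1 x f),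
         PX.-integrable setT (fun x => (phi1 x f)%:E),
         (\int[PX]_x (phi1 x f)%:E = 0)%E,
         (\int[PX]_x ((phi1 x f) ^+ 2)%:E < +oo)%E &
         op_sqrt P (fun n w =>
            inf [set empmean X n (fun x => g x th f) w | th in [set: Theta]]
            - inf [set d (fth th) f | th in [set: Theta]]
            - empmean X n (fun x => phi1 x f) w)])
  (M : nat) (hM : (0 < M)%N) :
  forall fs : 'I_M -> F, (forall m, G (fs m)) ->
  let dF_ f := inf [set d (fth th) f | th in [set: Theta]] in
  let dnF n f w := inf [set empmean X n (fun x => g x th f) w | th in [set: Theta]] in
  let dnb n f w := empmean X n (fun x => gbase x f) w in
  let mu1 := (M%:R)^-1 * \sum_(m < M) dF_ (fs m) in
  let mu0 := (M%:R)^-1 * \sum_(m < M) d fbase (fs m) in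
  let rM := mu1 / mu0 in
  let rhat n w := ((M%:R)^-1 * \sum_(m < M) dnF n (fs m) w) /
                  ((M%:R)^-1 * \sum_(m < M) dnb n (fs m) w) in
  let phi0 x f := gbase x f - d fbase f in
  let Phi1 x := (M%:R)^-1 * \sum_(m < M) phi1 x (fs m) in
  let Phi0 x := (M%:R)^-1 * \sum_(m < M) phi0 x (fs m) in
  let psiM x := mu0^-1 * (Phi1 x - rM * Phi0 x) in
  0 < mu0 ->
  cvg_dist_normal P (fun n w => Num.sqrt (n%:R) * (rhat n w - rM)) (varP PX psiM).
Proof.
move=> fs Gfs dF_ dnF dnb mu1 mu0 rM rhat phi0 Phi1 Phi0 psiM mu0_gt0.
have [eps [eps0 [_ [B hB]]]] := heps.
have mu0N0 : mu0 != 0 by rewrite gt_eqF.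
have sqgb m : square_integrable PX (gbase ^~ (fs m)).
  exact: (moment_square_integrable (hgbm _) eps0 (hB (fs m))).
have sq1 m : square_integrable PX (phi1 ^~ (fs m)).
  have [mphi _ _ phi2 _] := hphi _ (Gfs m); split => //.
  have m2 : measurable_fun setT (fun x => phi1 x (fs m) ^+ 2) by exact: measurable_funX.
  apply/integrableP; split; first exact/measurable_EFinP.
  by under eq_integral do rewrite /= ger0_norm ?sqr_ge0//.
have sq0 m : square_integrable PX (phi0 ^~ (fs m)).
  by apply: square_integrableB => //; exact: square_integrable_cst.
have sqPhi1 : square_integrable PX Phi1.
  exact/square_integrableZ/square_integrable_sum.
have sqPhi0 : square_integrable PX Phi0.
  exact/square_integrableZ/square_integrable_sum.
have sqpsi : square_integrable PX psiM.
  apply/square_integrableZ/square_integrableB => //.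
  exact: square_integrableZ.
have int f : square_integrable PX f -> PX.-integrable setT (EFin \o f).
  exact: square_integrable_integrable.
have E1 : Rintegral PX setT Phi1 = 0.
  rewrite /Phi1 RintegralZl//; last exact/int/square_integrable_sum.
  rewrite Rintegral_sum_square_integrable// big1 ?mulr0// => m _.
  by have [_ _ h _ _] := hphi _ (Gfs m); rewrite /Rintegral h.
have E0 : Rintegral PX setT Phi0 = 0.
  rewrite /Phi0 RintegralZl//; last exact/int/square_integrable_sum.
  rewrite Rintegral_sum_square_integrable// big1 ?mulr0// => m _.
  rewrite /phi0 RintegralB//; [|exact/int/sqgb|exact: integrable_cst_prob].
  by rewrite Rintegral_cst_prob -hdb// subrr.
have Epsi : Rintegral PX setT psiM = 0.
  rewrite /psiM RintegralZl//; last first.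
    by apply/int/square_integrableB => //; exact: square_integrableZ.
  rewrite RintegralB//; [|exact: int|exact/int/square_integrableZ].
  have -> : Rintegral PX setT (fun x => rM * Phi0 x) = rM * Rintegral PX setT Phi0.
    by apply: RintegralZl => //; exact: int.
  by rewrite E1 E0 mulr0 subr0 mulr0.
have -> : varP PX psiM = Rintegral PX setT (fun x => psiM x ^+ 2).
  by rewrite /varP Epsi; under eq_Rintegral do rewrite subr0.
pose rem m n w := dnF n (fs m) w - dF_ (fs m) - empmean X n (phi1 ^~ (fs m)) w.
have mrem m n : measurable_fun setT (rem m n).
  apply: measurable_funB; first apply: measurable_funB => //.
    exact: hdnm (Gfs m) n.
  by apply: (measurable_empmean hX); case: (sq1 m).
(* [W] is the linear term with the normal limit, [U] the scaled remainder of asymptotic linearity,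
   [b] the relative error of the denominator and [Y] the total linearization error. *)
pose W n w := Num.sqrt n%:R * empmean X n psiM w.
pose U n w := mu0^-1 * ((M%:R)^-1 * \sum_(m < M) Num.sqrt n%:R * rem m n w).
pose b n w := mu0^-1 * empmean X n Phi0 w.
pose Z n w := Num.sqrt n%:R * (rhat n w - rM).
pose Y n w := Z n w - W n w.
have mW n : measurable_fun setT (W n).
  by apply: measurable_funM => //; apply: (measurable_empmean hX); case: sqpsi.
have mU n : measurable_fun setT (U n).
  apply: measurable_funM => //; apply: measurable_funM => //.
  by apply: measurable_sum => m; exact: measurable_funM.
have mb n : measurable_fun setT (b n).
  by apply: measurable_funM => //; apply: (measurable_empmean hX); case: sqPhi0.
have mZ n : measurable_fun setT (Z n).
  apply: measurable_funM => //; apply: measurable_funB => //.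
  apply: measurable_funM.
    apply: measurable_funM => //; apply: measurable_sum => m.
    exact: hdnm (Gfs m) n.
  apply: measurable_funV_real; apply: measurable_funM => //.
  apply: measurable_sum => m; apply: (measurable_empmean hX).
  by case: (sqgb m).
have mY n : measurable_fun setT (Y n) by exact: measurable_funB.
have tW : tight P W := iid_tight hX sqpsi Epsi.
have hU : cvg_pr0 P U.
  do 2 apply: cvg_pr0Z; apply: cvg_pr0_sum => [m n|m].
    exact: measurable_funM.
  by have [_ _ _ _ op] := hphi _ (Gfs m); exact: op.
have hb : cvg_pr0 P b := cvg_pr0Z mu0^-1 (empmean_cvg_pr0 hX sqPhi0 E0).
have hY : cvg_pr0 P Y.
  apply: (@ratio_remainder_cvg_pr0 _ _ _ _ W U b) => //.
  (* Positivity of [n] is needed for the empirical mean of a constant to be that constant, which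
     centres [gbase] in the denominator. *)
  apply: filterS (nbhs_infty_gt 0) => n n0 w b2.
  set q : R := Num.sqrt n%:R.
  have denE : (M%:R)^-1 * \sum_(m < M) dnb n (fs m) w = mu0 * (1 + b n w).
    rewrite mulrDr mulr1 /b mulVKf// /Phi0 empmeanZ empmean_sum /mu0 -mulrDr.
    congr (_ * _); rewrite -big_split; apply: eq_bigr => m _ /=.
    by rewrite /phi0 empmeanB empmean_cst// addrC subrK.
  have numE : (M%:R)^-1 * \sum_(m < M) dnF n (fs m) w =
      rM * mu0 + empmean X n Phi1 w + (M%:R)^-1 * \sum_(m < M) rem m n w.
    rewrite /rM divfK// /Phi1 empmeanZ empmean_sum /mu1 -!mulrDr.
    congr (_ * _); rewrite -!big_split; apply: eq_bigr => m _ /=.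
    by rewrite /rem; ring.
  have UE : U n w = mu0^-1 * (q * ((M%:R)^-1 * \sum_(m < M) rem m n w)).
    by rewrite /U -mulr_sumr; congr (_ * _); rewrite mulrCA.
  have WE : W n w = mu0^-1 * (q * (empmean X n Phi1 w - rM * empmean X n Phi0 w)).
    by rewrite /W /psiM empmeanZ empmeanB (empmeanZ X n rM Phi0 w) mulrCA.
  (* On this event [(1 + b n w)^-1] is at most 2, the factor required by
     [ratio_remainder_cvg_pr0]. *)
  have b1 : 1 / 2 <= 1 + b n w.
    by move: b2; rewrite ler_norml => /andP[]; lra.
  have b1_gt0 : 0 < 1 + b n w by lra.
  have YE : Y n w = (U n w - b n w * W n w) / (1 + b n w).
    rewrite /Y /Z /rhat numE denE UE WE.
    rewrite (_ : empmean X n Phi0 w = mu0 * b n w); last by rewrite mulVKf.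
    by apply: ratio_expansion; rewrite ?gt_eqF.
  rewrite YE normrM (ger0_norm (x := _^-1)) ?invr_ge0 ?(ltW b1_gt0)//.
  rewrite mulrC ler_pM ?invr_ge0 ?(ltW b1_gt0)//.
    by rewrite -[leRHS]invrK lef_pV2 ?posrE ?invr_gt0//; lra.
  by rewrite -(normrM (b n w) (W n w)) ler_normB.
(* The error [Y] is discarded at each fixed smoothing scale; the passage to distribution functions
   comes afterwards, for [Z] itself. *)
apply: (@smoothed_cvg_dist _ _ _ P Z) => //.
- by apply: Rintegral_ge0 => x _; exact: sqr_ge0.
- move=> e t e0.
  have mpsi : measurable_fun setT psiM by case: sqpsi.
  have psi2 : PX.-integrable setT (EFin \o (fun x => psiM x ^+ 2)) by case: sqpsi.
  have lim := smooth_clt hX mpsi (int _ sqpsi) Epsi psi2 (t := t) e0.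
  have WYZ n w : W n w + Y n w = Z n w by rewrite /Y addrC subrK.
  have ZE : (fun n => Rintegral P setT (fun w => gauss_cdf 1 ((t - Z n w) / e))) =
      (fun n => Rintegral P setT (fun w => gauss_cdf 1 ((t - (W n w + Y n w)) / e))).
    by apply/funext => n; apply: eq_Rintegral => w _; rewrite WYZ.
  rewrite ZE; exact: smoothed_slutsky e0 mW mY hY lim.
Qed.
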